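(* Let $K=\bigcup_{N\ge1}\mathbb{C}(\!(t^{1/N})\!)$ be the field of complex Puiseux series with valuation $\mathrm{val}$ and valuation ring $\mathcal{O}_K$. Let $L\subset K^n$ be a lattice of rank $r$ that is not contained in any coordinate hyperplane of $K^n$, and let $\Sigma_L$ be the polyhedral complex attached to $L$ (defined in the context). Then \[\mathrm{trop}(L)=|\Sigma_L|\cap\mathbb{Q}^n .\] Moreover, the image of $|\Sigma_L|$ under the projection $\mathbb{R}^n\to\mathbb{R}^n/\mathbb{R}\mathbf{1}_n$ equals the tropical linear space $\mathrm{trop}(V_L)$, where $V_L:=L\otimes_{\mathcal{O}_K}K\subset K^n$. Consequently, $\dim(\Sigma_L)=\mathrm{rank}(L)$.
   Context: $K=\bigcup_{N\ge1}\mathbb{C}(\!(t^{1/N})\!)$ is the field of Puiseux series $\sum_{\alpha\in\mathbb{Z}}a_\alpha t^{\alpha/N}$ ($a_\alpha\in\mathbb{C}$, support bounded below), with valuation $\mathrm{val}(\mathbf f)=\min\{\alpha/N: a_\alpha\neq0\}$, $\mathrm{val}(0)=\infty$, and valuation ring $\mathcal{O}_K=\{\mathbf f:\mathrm{val}(\mathbf f)\ge0\}$. A lattice $L\subset K^n$ of rank $r$ is a set $L=\mathcal{O}_K^rA$, the $\mathcal{O}_K$-span of the rows of a full-rank matrix $A\in K^{r\times n}$. Its tropicalization is $\mathrm{trop}(L)=\{(\mathrm{val}(f_1),\dots,\mathrm{val}(f_n)) : (f_1,\dots,f_n)\in L\cap (K^\times)^n\}\subset\mathbb{R}^n$. The entropy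 vector $h(L)=(h_J)_{J\subset[n]}$ is $h_J=\min_{I\subset[r],|I|=|J|}\mathrm{val}(\det A_{I\times J})$, with $h_\varnothing=0$ and $h_J=\infty$ if $|J|>r$ (it does not depend on the choice of $A$). The entropy polynomial is $\varphi_L(v)=\max_{J\subset[n]}(v_J-h_J)$ for $v\in\mathbb{R}^n$, where $v_J=\sum_{j\in J}v_j$, $v_\varnothing=0$, and terms with $h_J=\infty$ are $-\infty$. Let $\mathcal{K}_L$ be the polyhedral complex subdividing $\mathbb{R}^n$ into the domains of linearity of $\varphi_L$: its maximal ($n$-dimensional) cells are the sets $\sigma_J=\{v: \varphi_L(v)=v_J-h_J\}$ that are $n$-dimensional, and its cells are these and all their faces. Label cells by $\ell(\sigma_J)=J$ for maximal cells and, for any cell $\tau$, $\ell(\tau)=\bigcup\{\ell(\sigma):\sigma \text{ maximal cell containing }\tau\}$. Then $\Sigma_L=\{\tau\in\mathcal{K}_L:\ell(\tau)=[n]\}$, a subcomplex, and $|\Sigma_L|$ is its support (union of its cells). $\mathbf{1}_n=(1,\dots,1)$. The tropical linear space $\mathrm{trop}(V_L)\subset\mathbb{R}^n/\mathbb{R}\mathbf{1}_n$ is the closure (in the Euclidean topology) of the image of $\{(\mathrm{val}(x_1),\dots,\mathrm{val}(x_n)): x\in V_L\cap(K^\times)^n\}$, i.e. the tropicalization of $\mathbb{P}(V_L)\subset\mathbb{P}^{n-1}$. *)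

(* Defs.v *)
From HB Require Import structures.
From mathcomp Require Import all_boot all_order all_algebra.
From mathcomp Require Import all_classical all_reals ereal topology.
From mathcomp Require Import generic_quotient complex.
Set Implicit Arguments.
Unset Strict Implicit.
Unset Printing Implicit Defensive.
Import Order.TTheory GRing.Theory Num.Theory.
Import numFieldTopology.Exports.
Local Open Scope classical_set_scope.
Local Open Scope ring_scope.
Local Open Scope complex_scope.
Local Open Scope quotient_scope.

Section PuiseuxSupport.
Variable F : fieldType.
Implicit Types (f g h : rat -> F) (N : nat) (m : int).

(* f stands for the series \sum_q f(q) t^q, here with exponents in (1/N)Z,
   bounded below by m/N. *)
Definition supp_in N m f : Prop :=
  forall q, f q != 0 -> exists2 a : int, m <= a & q = a%:~R / N%:R.

Definition is_puiseux f : Prop :=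
  exists (N : nat) (m : int), (0 < N)%N /\ supp_in N m f.

(* The summand has finite support as soon as f and g satisfy is_puiseux. *)
Definition pmul f g : rat -> F :=
  fun q => \sum_(a \in [set: rat]) f a * g (q - a).

Definition pidx N m (k : nat) : rat := (m + k%:Z)%:~R / N%:R.

Lemma pidx_inj N m : (0 < N)%N -> injective (pidx N m).
Proof.
move=> N0 i j; have NN : (N%:R : rat) != 0 by rewrite pnatr_eq0 -lt0n.
by move=> /(mulIf (invr_neq0 NN)) /eqP; rewrite eqr_int => /eqP/addrI [].
Qed.

Lemma pidxD N m m' i j : pidx N m i + pidx N m' j = pidx N (m + m') (i + j).
Proof. by rewrite /pidx -mulrDl -intrD PoszD addrACA. Qed.

Lemma supp_inP N m f q : supp_in N m f -> f q != 0 -> exists k, q = pidx N m k.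
Proof.
move=> s /s [a ma ->]; exists `|a - m|%N.
by rewrite /pidx gez0_abs ?subr_ge0 // subrKC.
Qed.

Lemma supp_in_pidx N m f : (forall q, f q != 0 -> exists k, q = pidx N m k) ->
  supp_in N m f.
Proof. by move=> H q /H[k ->]; exists (m + k%:Z); rewrite // lerDl. Qed.

Lemma supp_in_refine N d m m' f : (0 < d)%N -> m' <= m * d%:Z ->
  supp_in N m f -> supp_in (N * d) m' f.
Proof.
move=> d0 mm s q /s[a ma ->]; exists (a * d%:Z).
  by apply: le_trans mm _; rewrite ler_wpM2r.
rewrite intrM natrM invfM mulrACA -mulrA -[d%:Z%:~R]/(d%:R) .
by rewrite divff ?mulr1 // pnatr_eq0 -lt0n.
Qed.

Lemma common2 f g : is_puiseux f -> is_puiseux g ->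
  exists N m, [/\ (0 < N)%N, supp_in N m f & supp_in N m g].
Proof.
move=> [N [m [N0 sf]]] [N' [m' [N0' sg]]].
exists (N * N')%N, (Num.min (m * N'%:Z) (m' * N%:Z)); split.
- by rewrite muln_gt0 N0.
- by apply: supp_in_refine sf => //; rewrite ge_min lexx.
- by rewrite mulnC; apply: supp_in_refine sg => //; rewrite ge_min lexx orbT.
Qed.

Lemma common3 f g h : is_puiseux f -> is_puiseux g -> is_puiseux h ->
  exists N m, [/\ (0 < N)%N, supp_in N m f, supp_in N m g & supp_in N m h].
Proof.
move=> pf pg [N' [m' [N0' sh]]]; have [N [m [N0 sf sg]]] := common2 pf pg.
exists (N * N')%N, (Num.min (m * N'%:Z) (m' * N%:Z)); split.
- by rewrite muln_gt0 N0.
- by apply: supp_in_refine sf => //; rewrite ge_min lexx.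
- by apply: supp_in_refine sg => //; rewrite ge_min lexx.
- by rewrite mulnC; apply: supp_in_refine sh => //; rewrite ge_min lexx orbT.
Qed.

Lemma pmulE N m m' f g k : (0 < N)%N -> supp_in N m f -> supp_in N m' g ->
  pmul f g (pidx N (m + m') k) =
  \sum_(i < k.+1) f (pidx N m i) * g (pidx N m' (k - i)).
Proof.
move=> N0 sf sg.
have E i : (i < k.+1)%N ->
    pidx N (m + m') k - pidx N m i = pidx N m' (k - i).
  by move=> ik; apply/eqP; rewrite subr_eq [eqbRHS]addrC pidxD subnKC.
transitivity (\sum_(a \in pidx N m @` `I_k.+1) f a * g (pidx N (m + m') k - a)).
  apply/esym/fsbig_widen => // a [_ /=] na.
  apply/eqP; apply/negPn/negP; rewrite mulf_eq0 negb_or => /andP[fa ga].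
  have [i ai] := supp_inP sf fa; have [j aj] := supp_inP sg ga.
  apply: na; exists i => //=.
  have : pidx N (m + m') k = pidx N (m + m') (i + j).
    by rewrite -pidxD -ai -aj subrKC.
  by move=> /(pidx_inj N0) ->; rewrite ltnS leq_addr.
rewrite fsbig_image //; last by move=> i j _ _; apply: pidx_inj.
rewrite -(fsbig_ord _ _ (fun i => f (pidx N m i) * g (pidx N (m + m') k - pidx N m i))).
by apply: eq_bigr => i _; rewrite E.
Qed.

Lemma pmul_supp N m m' f g : supp_in N m f -> supp_in N m' g ->
  supp_in N (m + m') (pmul f g).
Proof.
move=> sf sg; apply: supp_in_pidx => q; apply: contraPP => nq.
apply/negP; rewrite negbK; apply/eqP; apply: fsbig1 => a _.
apply/eqP; apply/negPn/negP; rewrite mulf_eq0 negb_or => /andP[fa ga].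
have [i ai] := supp_inP sf fa; have [j aj] := supp_inP sg ga.
by apply: nq; exists (i + j)%N; rewrite -pidxD -ai -aj subrKC.
Qed.

Lemma supp_eq N m f g : supp_in N m f -> supp_in N m g ->
  (forall k, f (pidx N m k) = g (pidx N m k)) -> f = g.
Proof.
move=> sf sg E; apply/funext => q.
have [fq|/(supp_inP sf)[k ->]//] := eqVneq (f q) 0.
have [gq|/(supp_inP sg)[k ->]//] := eqVneq (g q) 0.
by rewrite fq gq.
Qed.

Lemma is_puiseux_mul f g : is_puiseux f -> is_puiseux g -> is_puiseux (pmul f g).
Proof.
move=> pf pg; have [N [m [N0 sf sg]]] := common2 pf pg.
by exists N, (m + m); split => //; apply: pmul_supp.
Qed.

Definition trunc_poly f N m k : {poly F} := \poly_(i < k.+1) f (pidx N m i).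

Lemma pmul_poly N m m' f g k j : (j <= k)%N ->
  (0 < N)%N -> supp_in N m f -> supp_in N m' g ->
  pmul f g (pidx N (m + m') j) = (trunc_poly f N m k * trunc_poly g N m' k)`_j.
Proof.
move=> jk N0 sf sg; rewrite (pmulE _ N0 sf sg) coefM; apply: eq_bigr => i _.
have ik : (i <= k)%N := leq_trans (leq_ord i) jk.
by rewrite !coef_poly !ltnS ik (leq_trans (leq_subr i j) jk).
Qed.

Lemma pmulC f g : is_puiseux f -> is_puiseux g -> pmul f g = pmul g f.
Proof.
move=> pf pg; have [N [m [N0 sf sg]]] := common2 pf pg.
apply: (@supp_eq N (m + m)); [exact: pmul_supp|exact: pmul_supp|] => k.
by rewrite !(@pmul_poly _ _ _ _ _ k) // mulrC.
Qed.

Lemma pmulA f g h : is_puiseux f -> is_puiseux g -> is_puiseux h ->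
  pmul f (pmul g h) = pmul (pmul f g) h.
Proof.
move=> pf pg ph; have [N [m [N0 sf sg sh]]] := common3 pf pg ph.
have sgh := pmul_supp sg sh; have sfg := pmul_supp sf sg.
apply: (@supp_eq N (m + (m + m))).
- exact: pmul_supp.
- by rewrite addrA; apply: pmul_supp.
move=> k; rewrite (pmulE _ N0 sf sgh).
transitivity ((trunc_poly f N m k *
   (trunc_poly g N m k * trunc_poly h N m k))`_k).
  rewrite coefM; apply: eq_bigr => i _; rewrite (@pmul_poly _ _ _ _ _ k) ?leq_subr //.
  by rewrite coef_poly ltn_ord.
rewrite mulrA addrA (pmulE _ N0 sfg sh) coefM; apply: eq_bigr => i _.
rewrite (@pmul_poly _ _ _ _ _ k) ?(leq_ord i) //.
by rewrite [X in _ * X = _]coef_poly ltnS leq_subr.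
Qed.

Definition pone : rat -> F := fun q => (q == 0)%:R.

Lemma pone_supp N : (0 < N)%N -> supp_in N 0 pone.
Proof.
move=> N0 q; rewrite /pone; case: (eqVneq q 0) => [-> _|_]; last by rewrite eqxx.
by exists 0; rewrite ?mul0r.
Qed.

Lemma pone_pidx N k : (0 < N)%N -> pone (pidx N 0 k) = (k == 0%N)%:R.
Proof.
move=> N0; rewrite /pone -[in RHS](inj_eq (pidx_inj N0 (m := 0))).
by rewrite {3}/pidx addr0 mul0r.
Qed.

Lemma is_puiseux1 : is_puiseux pone.
Proof. by exists 1%N, 0; split => //; apply: pone_supp. Qed.

Lemma pmul1 f : is_puiseux f -> pmul pone f = f.
Proof.
move=> [N [m [N0 sf]]]; have s1 := pone_supp N0.
apply: (@supp_eq N (0 + m)); [exact: pmul_supp|by rewrite add0r|] => k.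
rewrite (pmulE _ N0 s1 sf) big_ord_recl pone_pidx // mul1r subn0 add0r big1 ?addr0 //.
by move=> i _; rewrite pone_pidx // mul0r.
Qed.

Lemma supp_inD N m f g : supp_in N m f -> supp_in N m g -> supp_in N m (f \+ g).
Proof.
move=> sf sg q /=; have [fq|/sf//] := eqVneq (f q) 0.
by rewrite fq add0r => /sg.
Qed.

Lemma is_puiseuxD f g : is_puiseux f -> is_puiseux g -> is_puiseux (f \+ g).
Proof.
move=> pf pg; have [N [m [N0 sf sg]]] := common2 pf pg.
by exists N, m; split => //; apply: supp_inD.
Qed.

Lemma is_puiseuxN f : is_puiseux f -> is_puiseux (\- f).
Proof.
by move=> [N [m [N0 sf]]]; exists N, m; split => // q /=; rewrite oppr_eq0 => /sf.
Qed.

Lemma is_puiseux0 : is_puiseux (fun=> 0).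
Proof. by exists 1%N, 0; split => // q; rewrite eqxx. Qed.

Lemma pmulDl f g h : is_puiseux f -> is_puiseux g -> is_puiseux h ->
  pmul (f \+ g) h = pmul f h \+ pmul g h.
Proof.
move=> pf pg ph; have [N [m [N0 sf sg sh]]] := common3 pf pg ph.
apply: (@supp_eq N (m + m)).
- by apply: pmul_supp => //; apply: supp_inD.
- by apply: supp_inD; apply: pmul_supp.
move=> k /=; rewrite !(@pmulE _ m m) //; last exact: supp_inD.
by rewrite -big_split; apply: eq_bigr => i _; rewrite mulrDl.
Qed.

Lemma puiseux_ord f : is_puiseux f -> f <> (fun=> 0) ->
  exists N m, [/\ (0 < N)%N, supp_in N m f & f (m%:~R / N%:R) != 0].
Proof.
move=> [N [m [N0 sf]]] f0.
have [|k fk kmin] := @ex_minnP (fun k => f (pidx N m k) != 0).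
  apply: contrapT => nk; apply: f0; apply: (@supp_eq N m) => //.
    by move=> q; rewrite eqxx.
  by move=> k; apply/eqP; apply/negPn/negP => fk; apply: nk; exists k.
exists N, (m + k%:Z); split => // q fq; have [j qj] := supp_inP sf fq.
have kj : (k <= j)%N by apply: kmin; rewrite -qj.
by exists (m + j%:Z); rewrite ?lerD2l.
Qed.

Section Inverse.
Variable a : nat -> F.

(* The coefficients of the inverse power series, in reverse order. *)
Fixpoint invs (k : nat) : seq F := if k is k'.+1 then
  (- (a 0%N)^-1 * \sum_(i < k) a i.+1 * (invs k')`_i) :: invs k'
  else [:: (a 0%N)^-1].

Lemma invs_nth k i : (i <= k)%N -> (invs k)`_i = (invs (k - i))`_0.
Proof.
elim: k i => [|k IH] [|i] //.
by move=> ik; rewrite subSS -IH.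
Qed.

Lemma invs_mul k : a 0%N != 0 ->
  \sum_(i < k.+1) a i * (invs (k - i))`_0 = (k == 0%N)%:R.
Proof.
move=> a0; case: k => [|k]; first by rewrite big_ord1 /= divff.
rewrite big_ord_recl subn0 /= mulrA mulrN divff // mulN1r.
apply/eqP; rewrite addrC subr_eq0; apply/eqP/eq_bigr => i _ .
by rewrite [bump _ _]add1n subSS [in RHS]invs_nth // leq_ord.
Qed.
End Inverse.

Lemma puiseux_inv f : is_puiseux f -> f <> (fun=> 0) ->
  exists2 g, is_puiseux g & pmul g f = pone.
Proof.
move=> pf f0; have [N [m [N0 sf fm]]] := puiseux_ord pf f0.
pose a k := f (pidx N m k).
have a0 : a 0%N != 0 by rewrite /a /pidx addr0.
pose g q := if pselect (exists k, q = pidx N (- m) k) is left e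
            then (invs a (xget 0%N [set k | q = pidx N (- m) k]))`_0 else 0.
have gE k : g (pidx N (- m) k) = (invs a k)`_0.
  rewrite /g; case: pselect => [e|[]]; last by exists k.
  by case: xgetP => [j _ /= /(pidx_inj N0)->//|/(_ k)]; case.
have sg : supp_in N (- m) g.
  by apply: supp_in_pidx => q; rewrite /g; case: pselect => //; rewrite eqxx.
have pg : is_puiseux g by exists N, (- m).
exists g => //; rewrite pmulC //.
apply: (@supp_eq N (m + - m)).
- exact: pmul_supp.
- by rewrite subrr; apply: pone_supp.
move=> k; rewrite (pmulE _ N0 sf sg) subrr pone_pidx // -(invs_mul k a0).
by apply: eq_bigr => i _; rewrite gE.
Qed.

End PuiseuxSupport.

Record puiseux (F : fieldType) := Puiseux {
  pcoef :> rat -> F;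
  puiseuxP : is_puiseux pcoef }.

Section PuiseuxField.
Variable F : fieldType.
Local Notation K := (puiseux F).

Lemma puiseux_inj (x y : K) : pcoef x = pcoef y -> x = y.
Proof.
case: x y => [f pf] [g pg] /= e; case: _ / e in pg *.
by congr Puiseux; apply: Prop_irrelevance.
Qed.

HB.instance Definition _ := gen_eqMixin K.
HB.instance Definition _ := gen_choiceMixin K.

Definition puiseux0 : K := Puiseux (is_puiseux0 F).
Definition puiseux1 : K := Puiseux (is_puiseux1 F).
Definition puiseuxN (x : K) : K := Puiseux (is_puiseuxN (puiseuxP x)).
Definition puiseuxD (x y : K) : K := Puiseux (is_puiseuxD (puiseuxP x) (puiseuxP y)).
Definition puiseuxM (x y : K) : K :=
  Puiseux (is_puiseux_mul (puiseuxP x) (puiseuxP y)).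

Lemma puiseux_addA : associative puiseuxD.
Proof. by move=> x y z; apply/puiseux_inj/funext => q /=; rewrite addrA. Qed.
Lemma puiseux_addC : commutative puiseuxD.
Proof. by move=> x y; apply/puiseux_inj/funext => q /=; rewrite addrC. Qed.
Lemma puiseux_add0 : left_id puiseux0 puiseuxD.
Proof. by move=> x; apply/puiseux_inj/funext => q /=; rewrite add0r. Qed.
Lemma puiseux_addN : left_inverse puiseux0 puiseuxN puiseuxD.
Proof. by move=> x; apply/puiseux_inj/funext => q /=; rewrite addNr. Qed.

HB.instance Definition _ := GRing.isZmodule.Build K
  puiseux_addA puiseux_addC puiseux_add0 puiseux_addN.

Lemma puiseux_mulA : associative puiseuxM.
Proof. by move=> x y z; apply/puiseux_inj/pmulA; apply: puiseuxP. Qed.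
Lemma puiseux_mulC : commutative puiseuxM.
Proof. by move=> x y; apply/puiseux_inj/pmulC; apply: puiseuxP. Qed.
Lemma puiseux_mul1 : left_id puiseux1 puiseuxM.
Proof. by move=> x; apply/puiseux_inj/pmul1; apply: puiseuxP. Qed.
Lemma puiseux_mulD : left_distributive puiseuxM (@GRing.add K).
Proof. by move=> x y z; apply/puiseux_inj/pmulDl; apply: puiseuxP. Qed.
Lemma puiseux_1neq0 : puiseux1 != 0 :> K.
Proof.
apply/eqP => /(congr1 (fun x : K => x 0)) /= /eqP.
by rewrite /pone eqxx oner_eq0.
Qed.

HB.instance Definition _ := GRing.Zmodule_isComNzRing.Build K
  puiseux_mulA puiseux_mulC puiseux_mul1 puiseux_mulD puiseux_1neq0.

(* xget returns its default 0 when x has no inverse, that is when x = 0. *)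
Definition puiseuxV (x : K) : K := xget 0 [set y | y * x = 1].

Lemma puiseux_mulV (x : K) : x != 0 -> puiseuxV x * x = 1.
Proof.
move=> x0; have [|g pg gx] := puiseux_inv (puiseuxP x).
  by move=> e; case/eqP: x0; apply: puiseux_inj.
apply: (@xgetPex _ 0 [set y : K | y * x = 1]).
by exists (Puiseux pg); apply: puiseux_inj.
Qed.
Lemma puiseux_inv0 : puiseuxV 0 = 0.
Proof.
by rewrite /puiseuxV; case: xgetP => // y _ /= /esym/eqP; rewrite mulr0 oner_eq0.
Qed.

HB.instance Definition _ := GRing.ComNzRing_isField.Build K puiseux_mulV puiseux_inv0.

End PuiseuxField.

Section Valuation.
Variable R : realType.
Local Notation K := (puiseux R[i]).

Definition min_exponent (x : K) : rat :=
  xget 0 [set q | x q != 0 /\ forall q', x q' != 0 -> q <= q'].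

Lemma min_exponentP (x : K) : x != 0 ->
  x (min_exponent x) != 0 /\ forall q, x q != 0 -> min_exponent x <= q.
Proof.
move=> x0; have [|N [m [N0 sx xm]]] := puiseux_ord (puiseuxP x).
  by move=> e; case/eqP: x0; apply: puiseux_inj.
apply: (@xgetPex _ 0 [set q | x q != 0 /\ forall q', x q' != 0 -> q <= q']).
exists (m%:~R / N%:R); split=> // q /sx[a ma ->].
by rewrite ler_wpM2r ?invr_ge0 ?ler0n // ler_int.
Qed.

Definition puiseux_val (x : K) : \bar R :=
  if x == 0 then +oo%E else (ratr (min_exponent x))%:E.

End Valuation.

Section Lattices.
Variables (R : realType) (n : nat).
Local Notation K := (puiseux R[i]).

Definition lattice_span r (A : 'M[K]_(r, n)) : set 'rV[K]_n :=
  [set c *m A | c in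
    [set c : 'rV[K]_r | forall i, (0 <= puiseux_val (c 0%R i))%E]].

Definition lattice_basis r (L : set 'rV[K]_n) (A : 'M[K]_(r, n)) : Prop :=
  row_free A /\ L = lattice_span A.

(* The image of L \otimes_{O_K} K in K^n. *)
Definition Kspan (L : set 'rV[K]_n) : set 'rV[K]_n :=
  [set x | exists m (c : 'rV[K]_m) (B : 'M[K]_(m, n)),
     (forall i, L (row i B)) /\ x = c *m B].

Definition trop_set (S : set 'rV[K]_n) : set 'rV[R]_n :=
  [set v | exists2 x, S x &
     forall j, x 0 j != 0 /\ puiseux_val (x 0 j) = (v 0 j)%:E].

Definition rational_points : set 'rV[R]_n :=
  [set v | forall j, exists q : rat, v 0 j = ratr q].

Definition minor_det r (A : 'M[K]_(r, n)) (I : {set 'I_r}) (J : {set 'I_n}) : K :=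
  if #|I| =P #|J| is ReflectT eIJ then
    \det (mxsub (fun i => enum_val (cast_ord (esym eIJ) i)) enum_val A)
  else 0.

(* For #|J| > r the index set of the minimum is empty, hence the value +oo. *)
Definition entropy_vector r (A : 'M[K]_(r, n)) (J : {set 'I_n}) : \bar R :=
  \big[Order.min/+oo%E]_(I : {set 'I_r} | #|I| == #|J|)
    puiseux_val (minor_det A I J).

End Lattices.

Section Polyhedra.
Variables (R : realType) (n : nat).
Implicit Types S P F : set 'rV[R]_n.

Definition affine_hull S : set 'rV[R]_n :=
  [set v | exists m (c : 'rV[R]_m) (B : 'M[R]_(m, n)),
     [/\ forall i, S (row i B), \sum_i c 0 i = 1 & v = c *m B]].

Definition has_dim S (d : nat) : Prop :=
  exists (x : 'rV[R]_n) (W : 'M[R]_(d, n)),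
    row_free W /\ affine_hull S = [set x + c *m W | c in [set: 'rV[R]_d]].

Definition dotr (u v : 'rV[R]_n) : R := \sum_j u 0 j * v 0 j.

(* Nonempty faces; u = 0 gives P itself. *)
Definition face_of P F : Prop :=
  F !=set0 /\ exists u : 'rV[R]_n,
    F = [set x | P x /\ forall y, P y -> dotr u y <= dotr u x].

Definition complex_support (C : set (set 'rV[R]_n)) : set 'rV[R]_n :=
  \bigcup_(tau in C) tau.

Definition complex_dim (C : set (set 'rV[R]_n)) (d : nat) : Prop :=
  (exists2 tau, C tau & has_dim tau d) /\
  forall tau k, C tau -> has_dim tau k -> (k <= d)%N.

End Polyhedra.

Section EntropyComplex.
Variables (R : realType) (n : nat).
Variable h : {set 'I_n} -> \bar R.
Implicit Types (J : {set 'I_n}) (v : 'rV[R]_n) (tau : set 'rV[R]_n).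

Definition entropy_term J v : \bar R := ((\sum_(j in J) v 0%R j)%:E - h J)%E.

Definition entropy_poly v : \bar R :=
  \big[Order.max/-oo%E]_(J : {set 'I_n}) entropy_term J v.

Definition sigma_cell J : set 'rV[R]_n := [set v | entropy_poly v = entropy_term J v].

Definition maximal_cell J : Prop := has_dim (sigma_cell J) n.

Definition linearity_complex : set (set 'rV[R]_n) :=
  [set tau | exists2 J, maximal_cell J & face_of (sigma_cell J) tau].

Definition cell_label tau : {set 'I_n} :=
  (\bigcup_(J : {set 'I_n} | `[< maximal_cell J /\ tau `<=` sigma_cell J >]) J)%SET.

Definition Sigma_complex : set (set 'rV[R]_n) :=
  [set tau | linearity_complex tau /\ cell_label tau = [set: 'I_n]%SET].

End EntropyComplex.

Section TropicalTorus.
Variables (R : realType) (n : nat).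

Definition eqmod1 (v w : 'rV[R]_n) : bool :=
  `[< exists c : R, v = w + c *: const_mx 1 >].

Lemma eqmod1_refl : reflexive eqmod1.
Proof. by move=> v; apply/asboolP; exists 0; rewrite scale0r addr0. Qed.

Lemma eqmod1_sym : symmetric eqmod1.
Proof.
have imp v w : eqmod1 v w -> eqmod1 w v.
  by move=> /asboolP[c ->]; apply/asboolP; exists (- c); rewrite scaleNr addrK.
by move=> v w; apply/idP/idP; apply: imp.
Qed.

Lemma eqmod1_trans : transitive eqmod1.
Proof.
move=> w v u /asboolP[c ->] /asboolP[d ->]; apply/asboolP; exists (d + c).
by rewrite scalerDl addrA.
Qed.

Canonical eqmod1_equiv := EquivRel eqmod1 eqmod1_refl eqmod1_sym eqmod1_trans.

Local Notation tropical_torus := (quotient_topology {eq_quot eqmod1_equiv}).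

Definition torus_proj (v : 'rV[R]_n) : tropical_torus :=
  \pi_tropical_torus v.

Definition trop_linear_space (V : set 'rV[puiseux R[i]]_n) :
    set tropical_torus :=
  closure (torus_proj @` trop_set V).

End TropicalTorus.

(* Main.v *)
(** The minors of all sizes of [A] are, up to sign, the maximal minors of the extended
    matrix [E = [1 | A]]; give its columns the weights [0] (left block) and [v_j] (right
    block).  A set [J] is active at [v] iff it consists of the right columns of a basis
    [s] of columns of [E] maximising weight minus valuation of the determinant, which by
    Cramer's rule and the Leibniz formula means [val (T k a) >= w a - w (s k)] for all
    entries of [T = E_s^-1 E].  So [v] lies in the support of the complex iff every right
    column [j] has an entry of [T] with equality.  If [v] is rational, the combination of
    the rows of [T] with coefficients [z^k t^(w (s k))], [z] generic, is then a lattice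
    point of valuation [v]; conversely, expanding a lattice point of valuation [v] in the
    rows of [T] produces the equalities.  The equalities only involve rational constants,
    so they survive a small perturbation of [v] to a rational point, which gives the
    statement on the tropical linear space.  They express all coordinates of a cell
    through [r] of them, which bounds the dimension. *)
Require Import Defs.
From mathcomp Require Import all_boot all_order all_algebra.
From mathcomp Require Import all_classical all_reals ereal topology.
From mathcomp Require Import complex.
From mathcomp Require Import perm lra.
Set Implicit Arguments.
Unset Strict Implicit.
Unset Printing Implicit Defensive.
Import Order.TTheory GRing.Theory Num.Theory.
Import numFieldTopology.Exports.
Local Open Scope classical_set_scope.
Local Open Scope ring_scope.
Local Open Scope complex_scope.

(** * Real valuations of Puiseux series, and monomials *)

Section PuiseuxValuation.
Variable R : realType.
Local Notation K := (puiseux R[i]).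
Implicit Types (x y : K) (a b : R) (q : rat).

Lemma puiseux_coef_sum I (s : seq I) (P : pred I) (F : I -> K) q :
  (\sum_(i <- s | P i) F i) q = \sum_(i <- s | P i) F i q.
Proof. by elim/big_rec2: _ => // i y1 y2 _ <-. Qed.

Lemma puiseux_coefM_witness x y q : (x * y) q != 0 ->
  exists q1 q2, [/\ q = q1 + q2, x q1 != 0 & y q2 != 0].
Proof.
apply: contraPP => nq; apply/negP; rewrite negbK; apply/eqP.
apply: fsbig1 => a _; apply/eqP; rewrite mulf_eq0; apply/orP.
have [_|xa] := eqVneq (x a) 0; first by left.
have [_|ya] := eqVneq (y (q - a)) 0; first by right.
by case: nq; exists a, (q - a); rewrite subrKC.
Qed.

Lemma puiseux_coefM1 x y p q :
  (forall p', p' != p -> x p' * y (q - p') = 0) -> (x * y) q = x p * y (q - p).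
Proof.
move=> xy0; transitivity (\sum_(p' \in [set p]) x p' * y (q - p')).
  by apply/esym/fsbig_widen => // p' [_ /= /eqP/xy0].
by rewrite fsbig_set1.
Qed.

(* The inequality [val x >= a], with the convention [val 0 = +oo]. *)
Definition vge a x : Prop := forall q, x q != 0 -> a <= ratr q.
(* The valuation of a nonzero series; [rval 0] is a junk value. *)
Definition rval x : R := ratr (min_exponent x).

Lemma rval_min x q : x q != 0 -> rval x <= ratr q.
Proof.
move=> xq; rewrite ler_rat; apply: (min_exponentP _).2 => //.
by apply: contraNneq xq => ->.
Qed.

Lemma vgeE a x : x != 0 -> vge a x <-> a <= rval x.
Proof.
move=> x0; split=> [|ax q /rval_min]; last exact: le_trans.
by apply; apply: (min_exponentP x0).1.
Qed.

Lemma vge0 a : vge a 0.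
Proof. by move=> q; rewrite eqxx. Qed.

Lemma vge_le a b x : a <= b -> vge b x -> vge a x.
Proof. by move=> ab bx q /bx; apply: le_trans. Qed.

Lemma vge_sum a I (s : seq I) (P : pred I) (F : I -> K) :
  (forall i, P i -> vge a (F i)) -> vge a (\sum_(i <- s | P i) F i).
Proof.
move=> F0; elim/big_ind: _ => [|x y ax ay q /=|//]; first exact: vge0.
by have [->|/ax//] := eqVneq (x q) 0; rewrite add0r => /ay.
Qed.

Lemma vgeM a b x y : vge a x -> vge b y -> vge (a + b) (x * y).
Proof.
move=> ax byy q /puiseux_coefM_witness[q1 [q2 [-> /ax aq /byy bq]]].
by rewrite rmorphD lerD.
Qed.

Lemma vge_sign a (b : bool) x : vge a x -> vge a ((-1) ^+ b * x).
Proof.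
case: b; rewrite ?mul1r //= expr1 mulN1r => ax q.
by rewrite [_ q]/= oppr_eq0 => /ax.
Qed.

Lemma rvalM x y : x != 0 -> y != 0 -> rval (x * y) = rval x + rval y.
Proof.
move=> x0 y0; have [xm xle] := min_exponentP x0; have [ym yle] := min_exponentP y0.
apply/eqP; rewrite eq_le; apply/andP; split; last first.
  by apply/vgeE; [rewrite mulf_neq0|apply: vgeM; apply/vgeE].
(* At the sum of the two minimal exponents the coefficient of [x * y] is the product of the leading
   coefficients: no other pair of exponents contributes. *)
rewrite /rval -rmorphD; apply: rval_min.
rewrite (@puiseux_coefM1 _ _ (min_exponent x)) => [|p pm].
  by rewrite addrAC subrr add0r mulf_neq0.
apply/eqP; rewrite mulf_eq0; apply/orP.
have [_|/xle xp] := eqVneq (x p) 0; first by left.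
have [_|/yle yp] := eqVneq (y (min_exponent x + min_exponent y - p)) 0; first by right.
by case/eqP: pm; apply/le_anti; rewrite xp andbT; lra.
Qed.

Lemma rvalN x : rval (- x) = rval x.
Proof.
have [->|x0] := eqVneq x 0; first by rewrite oppr0.
have xN0 : - x != 0 by rewrite oppr_eq0.
have vN a y : vge a y -> vge a (- y) by move=> /(@vge_sign _ true); rewrite expr1 mulN1r.
apply/le_anti/andP; split; apply/vgeE => //.
  by rewrite -{2}[x]opprK; apply: vN; apply/vgeE.
by apply: vN; apply/vgeE.
Qed.

Lemma rval_sign (b : bool) x : rval ((-1) ^+ b * x) = rval x.
Proof. by case: b; rewrite ?mul1r //= expr1 mulN1r rvalN. Qed.

Lemma rval1 : rval 1 = 0.
Proof. by have := @rvalM 1 1; rewrite mulr1 oner_neq0 => /(_ isT isT); lra. Qed.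

Lemma rvalV x : x != 0 -> rval x^-1 = - rval x.
Proof.
by move=> x0; have := rvalM x0 (invr_neq0 x0); rewrite divff // rval1; lra.
Qed.

Lemma rval_prod I (s : seq I) (F : I -> K) :
  \prod_(i <- s) F i != 0 -> rval (\prod_(i <- s) F i) = \sum_(i <- s) rval (F i).
Proof.
elim: s => [|i s IHs]; first by rewrite !big_nil rval1.
by rewrite !big_cons mulf_eq0 negb_or => /andP[i0 s0]; rewrite rvalM // IHs.
Qed.

(** The leading exponent of a sum occurs in one of its summands. This form of the ultrametric
    inequality names a summand, and the equalities [tight] are obtained from it. *)
Lemma rval_sum_witness I (s : seq I) (P : pred I) (F : I -> K) :
  \sum_(i <- s | P i) F i != 0 ->
  exists i, [/\ P i, F i != 0 & rval (F i) <= rval (\sum_(i <- s | P i) F i)].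
Proof.
move=> s0; have [sm _] := min_exponentP s0; apply: contrapT => nF.
case/eqP: sm; rewrite puiseux_coef_sum; apply: big1 => i Pi.
apply/eqP; apply: contrapT => /negP Fi; apply: nF; exists i; split => //.
  by apply: contraNneq Fi => ->.
exact: rval_min.
Qed.

Lemma puiseux_valE a x : x != 0 -> puiseux_val x = a%:E <-> rval x = a.
Proof.
by move=> x0; rewrite /puiseux_val (negPf x0); split=> [[]|<-].
Qed.

Lemma puiseux_val_ge0 x : (0 <= puiseux_val x)%E <-> vge 0 x.
Proof.
rewrite /puiseux_val; have [->|x0] := eqVneq x 0.
  by split=> _; [exact: vge0|rewrite leey].
by rewrite lee_fin; apply: iff_sym; apply: vgeE.
Qed.

Definition monom_fun (c : R[i]) q : rat -> R[i] := fun p => if p == q then c else 0.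

Lemma monom_funP c q : is_puiseux (monom_fun c q).
Proof.
exists `|denq q|%N, (numq q); split; first by rewrite absz_gt0 denq_neq0.
move=> p; rewrite /monom_fun; case: (p =P q) => [-> _|]; last by rewrite eqxx.
exists (numq q) => //; rewrite -[in LHS](divq_num_den q); congr (_ / _).
by rewrite -[X in X%:~R]absz_denq.
Qed.

Definition monom c q : K := Puiseux (monom_funP c q).

Lemma monom_coef c q x p : (monom c q * x) p = c * x (p - q).
Proof.
rewrite (@puiseux_coefM1 _ _ q) /= /monom_fun; first by rewrite eqxx.
by move=> p' /negPf ->; rewrite mul0r.
Qed.

Lemma vge_monom c q : vge (ratr q) (monom c q).
Proof.
by move=> p /=; rewrite /monom_fun; case: (p =P q) => [->//|]; rewrite eqxx.
Qed.

Lemma monom_neq0 q : monom 1 q != 0.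
Proof.
apply/eqP => /(congr1 (fun x : K => x q)) /eqP.
by rewrite /= /monom_fun eqxx oner_eq0.
Qed.

Lemma rval_monom q : rval (monom 1 q) = ratr q.
Proof.
apply/le_anti/andP; split; first by apply: rval_min; rewrite /= /monom_fun eqxx oner_neq0.
by apply/vgeE; [exact: monom_neq0|exact: vge_monom].
Qed.

End PuiseuxValuation.

(* Generalising first keeps [lra] from comparing distinct series up to conversion. *)
Ltac rlra := repeat match goal with
  | |- context [@rval ?R ?x] => generalize (@rval R x); intro
  end; lra.

(** * Column bases of a matrix over [K], and their exchange *)

Section Bases.
Variables (R : realType) (r m : nat).
Local Notation K := (puiseux R[i]).
Variable E : 'M[K]_(r, m).
Implicit Types (s : 'I_r -> 'I_m) (w : 'I_m -> R) (k : 'I_r) (a : 'I_m).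

Definition bdet s : K := \det (colsub s E).
(* The matrix [E] rewritten in the basis of its columns indexed by [s]. *)
Definition bmx s : 'M[K]_(r, m) := invmx (colsub s E) *m E.
Definition subst_col s k a : 'I_r -> 'I_m := fun i => if i == k then a else s i.
Definition weight w s : R := \sum_i w (s i).

(* [s] maximises [weight w s - val (bdet s)], in local form, see [optimal_le]. *)
Definition optimal w s : Prop :=
  bdet s != 0 /\ forall k a, vge (w a - w (s k)) (bmx s k a).
Definition tight w s k a : Prop :=
  bmx s k a != 0 /\ rval (bmx s k a) = w a - w (s k).

Lemma bdet_unit s : bdet s != 0 -> colsub s E \in unitmx.
Proof. by rewrite unitmxE unitfE. Qed.

Lemma colsub_mul p q (B : 'M[K]_(p, r)) (f : 'I_q -> 'I_m) :
  colsub f (B *m E) = B *m colsub f E.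
Proof. by rewrite mxsub_mul mxsub_id. Qed.

Lemma mul_bmx s : bdet s != 0 -> colsub s E *m bmx s = E.
Proof. by move=> s0; rewrite mulKVmx // bdet_unit. Qed.

Lemma colsub_bmx s : bdet s != 0 -> colsub s (bmx s) = 1%:M.
Proof. by move=> s0; rewrite colsub_mul mulVmx // bdet_unit. Qed.

Lemma bmx_basis s k i : bdet s != 0 -> bmx s k (s i) = (k == i)%:R.
Proof. by move=> /colsub_bmx/matrixP/(_ k i); rewrite !mxE. Qed.

Lemma bmx_trans s s' : bdet s' != 0 -> bmx s = colsub s' (bmx s) *m bmx s'.
Proof. by move=> s'0; rewrite colsub_mul -mulmxA mul_bmx. Qed.

Lemma det_bmx s s' : \det (colsub s' (bmx s)) = bdet s' / bdet s.
Proof. by rewrite colsub_mul det_mulmx det_inv mulrC. Qed.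

Lemma bdet_neq0_inj s : bdet s != 0 -> injective s.
Proof.
move=> s0 i j sij; apply/eqP; have /eqP := bmx_basis i j s0.
rewrite -sij bmx_basis // eqxx; case: (i =P j) => // _.
by rewrite /= oner_eq0.
Qed.

Lemma bmx_cramer s k a : bdet s != 0 -> bmx s k a = bdet (subst_col s k a) / bdet s.
Proof.
(* Replacing column [k] leaves the cofactors along that column unchanged. *)
have cof i : cofactor (colsub (subst_col s k a) E) i k = cofactor (colsub s E) i k.
  rewrite /cofactor; congr (_ * \det _); apply/matrixP => p q; rewrite !mxE.
  by rewrite /subst_col eq_sym (negPf (neq_lift _ _)).
move=> s0; rewrite {1}/bdet (expand_det_col _ k) mulr_suml mxE; apply: eq_bigr => i _.
rewrite cof /invmx bdet_unit // !mxE /subst_col eqxx -[\det _]/(bdet s).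
by rewrite [LHS]mulrC mulrCA [LHS]mulrC.
Qed.

Lemma weight_subst w s k a : weight w (subst_col s k a) = weight w s + w a - w (s k).
Proof.
rewrite /weight (bigD1 k) //= [in RHS](bigD1 k) //= /subst_col eqxx.
rewrite (eq_bigr (fun i => w (s i))) => [|i /negPf -> //]; rlra.
Qed.

(** By Cramer's rule the entry is a ratio of basis determinants, so the bound on its valuation says
    that exchanging [s k] for [a] does not improve [s]. *)
Lemma vge_bmx w s k a : bdet s != 0 ->
  (bdet (subst_col s k a) != 0 ->
   rval (bdet s) - weight w s <=
   rval (bdet (subst_col s k a)) - weight w (subst_col s k a)) ->
  vge (w a - w (s k)) (bmx s k a).
Proof.
move=> s0; rewrite bmx_cramer //.
have [->|b0] := eqVneq (bdet (subst_col s k a)) 0.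
  by move=> _; rewrite mul0r; apply: vge0.
move=> /(_ isT) le; apply/vgeE; first by rewrite mulf_neq0 ?invr_neq0.
rewrite rvalM ?invr_neq0 // rvalV //; move: le; rewrite weight_subst; rlra.
Qed.

(** A minimiser exists among the finitely many bases with columns in [Q]. Taking [Q] to be the right
    block of the extended matrix yields bases made of columns of [A] alone. *)
Lemma minimal_basis (Q : pred 'I_m) w :
  (exists2 s, bdet s != 0 & forall i, Q (s i)) ->
  exists s, [/\ bdet s != 0, forall i, Q (s i) &
    forall k a, Q a -> vge (w a - w (s k)) (bmx s k a)].
Proof.
move=> [s0 s00 Qs0].
pose P (f : {ffun 'I_r -> 'I_m}) := (bdet f != 0) && [forall i, Q (f i)].
have bdet_ext s s' : s =1 s' -> bdet s = bdet s'.
  by move=> ss'; congr (\det _); apply/matrixP => i j; rewrite !mxE ss'.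
have P0 : P (finfun s0).
  rewrite /P (bdet_ext _ s0) ?s00 //=; last exact: ffunE.
  by apply/forallP => i; rewrite ffunE.
case: (Order.TotalTheory.arg_minP (fun f : {ffun 'I_r -> 'I_m} => rval (bdet f) - weight w f) P0).
move=> s /andP[bs /forallP Qs] smin; exists s; split => // k a Qa.
apply: vge_bmx => // bs'.
have e : finfun (subst_col s k a) =1 subst_col s k a by apply: ffunE.
have -> : weight w (subst_col s k a) = weight w (finfun (subst_col s k a)).
  by apply: eq_bigr => i _; rewrite e.
rewrite -(bdet_ext _ _ e); apply: smin; rewrite /P (bdet_ext _ _ e) bs'; apply/forallP => i.
by rewrite ffunE /subst_col; case: ifP.
Qed.

(** The determinant of [colsub s' (bmx s)] is [bdet s' / bdet s]. Some term of its Leibniz expansion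
    has valuation at most that of the determinant, and the permutation of that term is [p]. *)
Lemma exchange s s' : bdet s != 0 -> bdet s' != 0 ->
  exists p : 'S_r, (forall i, bmx s (p i) (s' i) != 0) /\
    \sum_i rval (bmx s (p i) (s' i)) <= rval (bdet s') - rval (bdet s).
Proof.
move=> s0 s'0; have d0 : \det (colsub s' (bmx s)) != 0.
  by rewrite det_bmx mulf_neq0 ?invr_neq0.
move: d0; rewrite -det_tr => d0; have [p [_ p0 le]] := rval_sum_witness d0.
have {}le := le_trans le (lexx (rval (\det (colsub s' (bmx s))^T))).
move: le; rewrite det_tr det_bmx rvalM ?invr_neq0 // rvalV // rval_sign.
move: p0; rewrite mulf_eq0 negb_or => /andP[_ p0]; rewrite rval_prod // => le.
have e i : (colsub s' (bmx s))^T i (p i) = bmx s (p i) (s' i) by rewrite !mxE.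
exists p; split => [i|]; first by move/prodf_neq0: p0 => /(_ i isT); rewrite e.
by under eq_bigr do rewrite -e.
Qed.

Lemma weightB_perm w s s' (p : 'S_r) :
  \sum_i (w (s' i) - w (s (p i))) = weight w s' - weight w s.
Proof.
by rewrite sumrB /weight [\sum_i w (s i)](reindex_inj (@perm_inj _ p)).
Qed.

(** Local optimality is global: the local inequalities are summed along the permutation given by
    [exchange]. *)
Lemma optimal_le w s s' : optimal w s -> bdet s' != 0 ->
  rval (bdet s) - weight w s <= rval (bdet s') - weight w s'.
Proof.
move=> [s0 os] s'0; have [p [p0 le]] := exchange s0 s'0.
have: \sum_i (w (s' i) - w (s (p i))) <= \sum_i rval (bmx s (p i) (s' i)).
  by apply: ler_sum => i _; apply/vgeE.
by rewrite (weightB_perm w s s' p); move: le; rlra.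
Qed.

(** Two optimal bases have the same value [rval (bdet s) - weight w s], so the inequalities summed
    in [optimal_le] are all equalities. The permutation is chosen before [w], which makes these
    equalities uniform on a cell. *)
Lemma optimal_exchange s s' : bdet s != 0 -> bdet s' != 0 ->
  exists p : 'S_r, forall w, optimal w s -> optimal w s' ->
    forall i, tight w s (p i) (s' i).
Proof.
move=> s0 s'0; have [p [p0 le]] := exchange s0 s'0; exists p => w os os' i.
split => //; apply/le_anti/andP; split; last by apply/vgeE => //; apply: os.2.
have le' : \sum_(j | j != i) (w (s' j) - w (s (p j))) <=
    \sum_(j | j != i) rval (bmx s (p j) (s' j)).
  by apply: ler_sum => j _; apply/vgeE => //; apply: os.2.
have := weightB_perm w s s' p; have := optimal_le os' s0; rewrite (bigD1 i) //=.
by move: le; rewrite (bigD1 i) //=; rlra.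
Qed.

(** A partial converse of [optimal_exchange]: equalities along [p] bound the value of [s'] by the
    optimal value of [s]. *)
Lemma optimal_swap w s s' : optimal w s -> bdet s' != 0 ->
  (exists2 p : 'S_r, forall i, tight w s (p i) (s' i) &
    rval (bdet s') - rval (bdet s) <= \sum_i rval (bmx s (p i) (s' i))) ->
  optimal w s'.
Proof.
move=> os s'0 [p tp le]; split => // k a; apply: vge_bmx => // s''0.
apply: le_trans (optimal_le os s''0); move: le.
by rewrite (eq_bigr _ (fun i _ => (tp i).2)) (weightB_perm w s s' p); rlra.
Qed.

(** A tight entry is an exchange that leaves [rval (bdet s) - weight w s] unchanged. *)
Lemma optimal_subst w s k a : optimal w s -> tight w s k a ->
  optimal w (subst_col s k a).
Proof.
move=> os [t0 te]; have s0 := os.1.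
have sub0 : bdet (subst_col s k a) != 0.
  by apply: contraNneq t0; rewrite bmx_cramer // => ->; rewrite mul0r.
split => // k' a'; apply: vge_bmx => // s''0.
apply: le_trans (optimal_le os s''0); move: te.
by rewrite weight_subst bmx_cramer // rvalM ?invr_neq0 // rvalV //; rlra.
Qed.

End Bases.

(** * Minors of [A] as maximal minors of [[1 | A]] *)

Lemma det_reindex (T : comNzRingType) p r (e : 'I_p -> 'I_r) (M : 'M[T]_r) :
  injective e -> p = r -> \det (mxsub e e M) = \det M.
Proof.
move=> e_inj pr; case: _ / (esym pr) in e e_inj *.
have -> : mxsub e e M = row_perm (perm e_inj) (col_perm (perm e_inj) M).
  by apply/matrixP => i j; rewrite !mxE !permE.
rewrite row_permE col_permE !det_mulmx !det_perm odd_permV [\det M * _]mulrC mulrA.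
by rewrite -signr_addb addbb mul1r.
Qed.

Lemma codom_perm r m (s s' : 'I_r -> 'I_m) : injective s -> injective s' ->
  {subset codom s <= codom s'} -> exists p : 'S_r, forall i, s i = s' (p i).
Proof.
move=> s_inj s'_inj ss'; have sc i : s i \in codom s' by apply/ss'/codom_f.
have f_inj : injective (fun i => iinv (sc i)).
  by move=> i j /(congr1 s'); rewrite !f_iinv => /s_inj.
by exists (perm f_inj) => i; rewrite permE f_iinv.
Qed.

Section ExtendedMatrix.
Variables (R : realType) (r n : nat).
Local Notation K := (puiseux R[i]).
Variable A : 'M[K]_(r, n).
Implicit Types (s : 'I_r -> 'I_(r + n)) (v : 'rV[R]_n).
Implicit Types (I : {set 'I_r}) (J : {set 'I_n}).

Definition ext_mx : 'M[K]_(r, r + n) := row_mx 1%:M A.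
Definition ext_weight v (a : 'I_(r + n)) : R :=
  match fintype.split a with inl _ => 0 | inr j => v 0 j end.
Definition lset s : {set 'I_r} := [set i | lshift n i \in codom s]%SET.
Definition rset s : {set 'I_n} := [set j | rshift r j \in codom s]%SET.

Lemma ext_weightl v i : ext_weight v (lshift n i) = 0.
Proof. by rewrite /ext_weight; case: split_ordP => j // /eqP; rewrite eq_lrshift. Qed.

Lemma ext_weightr v j : ext_weight v (rshift r j) = v 0 j.
Proof.
rewrite /ext_weight; case: split_ordP => k; first by move=> /eqP; rewrite eq_rlshift.
by move=> /rshift_inj ->.
Qed.

Lemma sum_codom (V : nmodType) s (F : 'I_(r + n) -> V) : injective s ->
  \sum_i F (s i) =
  \sum_(i in lset s) F (lshift n i) + \sum_(j in rset s) F (rshift r j).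
Proof.
move=> s_inj; transitivity (\sum_(a in codom s) F a).
  by rewrite -big_image /= big_uniq // map_inj_uniq // enum_uniq.
rewrite big_mkcond big_split_ord /= -!big_mkcond /=.
by congr (_ + _); apply: eq_bigl => i; rewrite inE.
Qed.

Lemma weight_rset v s : injective s ->
  weight (ext_weight v) s = \sum_(j in rset s) v 0 j.
Proof.
move=> s_inj; rewrite /weight sum_codom // big1 ?add0r => [|i _].
  by apply: eq_bigr => j _; rewrite ext_weightr.
exact: ext_weightl.
Qed.

Lemma card_lset s : injective s -> (#|lset s| + #|rset s| = r)%N.
Proof.
move=> s_inj; rewrite -!sum1_card -[RHS]card_ord -sum1_card.
by rewrite [RHS](sum_codom (fun=> 1%N) s_inj).
Qed.

(** The basis keeps the identity column [i] for each [i] outside [I] and puts the columns of [J] at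
    the indices in [I]. Listing rows and columns with [I] first gives a block triangular matrix with
    an identity block, so the determinant is the minor itself, without a sign. *)
Lemma minor_basis I J : #|I| = #|J| ->
  exists s, [/\ injective s, lset s = (~: I)%SET, rset s = J &
    bdet ext_mx s = minor_det A I J].
Proof.
move=> eIJ; pose f k : 'I_r := enum_val (cast_ord (esym eIJ) k).
have fI k : f k \in I by apply: enum_valP.
have f_inj : injective f by move=> k l /enum_val_inj/cast_ord_inj.
have If i : i \in I -> exists k, f k = i.
  move=> iI; exists (cast_ord eIJ (enum_rank_in iI i)).
  by rewrite /f cast_ordK enum_rankK_in.
pose s i := if [pick k | f k == i] is Some k then rshift r (enum_val k) else lshift n i.
have sf k : s (f k) = rshift r (enum_val k).
  rewrite /s; case: pickP => [l /eqP/f_inj->//|/(_ k)]; by rewrite eqxx.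
have sN i : i \notin I -> s i = lshift n i.
  move=> iI; rewrite /s; case: pickP => // k /eqP fk.
  by move: iI; rewrite -fk fI.
have s_inj : injective s.
  move=> i j; have [/If[k <-]|iI] := boolP (i \in I);
    have [/If[l <-]|jI] := boolP (j \in I); rewrite ?sf ?sN //.
  - by move=> /rshift_inj/enum_val_inj ->.
  - by move=> /eqP; rewrite eq_rlshift.
  - by move=> /eqP; rewrite eq_lrshift.
  - exact: lshift_inj.
have ls : lset s = (~: I)%SET.
  apply/setP => i; rewrite !inE; apply/codomP/idP => [[j +]|iI]; last first.
    by exists i; rewrite sN.
  have [/If[k <-]|jI] := boolP (j \in I).
    by rewrite sf => /eqP; rewrite eq_lrshift.
  by rewrite sN // => /lshift_inj ->.
have rs : rset s = J.
  apply/setP => j; rewrite !inE; apply/codomP/idP => [[i +]|jJ].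
    have [/If[k <-]|iI] := boolP (i \in I).
      by rewrite sf => /rshift_inj ->; apply: enum_valP.
    by rewrite sN // => /eqP; rewrite eq_rlshift.
  by exists (f (enum_rank_in jJ j)); rewrite sf enum_rankK_in.
exists s; split => //.
pose g (l : 'I_#|(~: I)%SET|) : 'I_r := enum_val l.
have gI l : g l \notin I by have := enum_valP l; rewrite inE.
pose e (u : 'I_(#|J| + #|(~: I)%SET|)) : 'I_r :=
  match fintype.split u with inl k => f k | inr l => g l end.
have e_inj : injective e.
  move=> u u'; rewrite /e; case: split_ordP => k ->; case: split_ordP => l -> fg.
  - by rewrite (f_inj _ _ fg).
  - by have := gI l; rewrite -fg fI.
  - by have := gI k; rewrite fg fI.
  - by rewrite (enum_val_inj fg).
have er : (#|J| + #|(~: I)%SET|)%N = r by rewrite -eIJ cardsC card_ord.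
rewrite /bdet -(det_reindex (colsub s ext_mx) e_inj er) /minor_det.
have el k : e (lshift _ k) = f k.
  by rewrite /e; case: split_ordP => l /eqP; rewrite ?eq_lrshift // => /eqP/lshift_inj ->.
have eR l : e (rshift _ l) = g l.
  by rewrite /e; case: split_ordP => k /eqP; rewrite ?eq_rlshift // => /eqP/rshift_inj ->.
case: eqP => // eIJ'; rewrite (eq_irrelevance eIJ' eIJ).
set M := mxsub e e _; set N := mxsub _ _ _.
have splitl i : fintype.split (lshift n i) = inl i := unsplitK (inl i).
have splitr j : fintype.split (rshift r j) = inr j := unsplitK (inr j).
have -> : M = block_mx N 0 (dlsubmx M) 1%:M.
  rewrite -[LHS]submxK; congr block_mx; apply/matrixP => k l; rewrite !mxE.
  - by rewrite !el sf splitr.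
  - rewrite el eR sN // splitl mxE; case: (f k =P g l) => // fg.
    by have := gI l; rewrite -fg fI.
  - by rewrite !eR sN // splitl mxE (inj_eq enum_val_inj).
by rewrite det_lblock det1 mulr1.
Qed.

(** Up to a permutation of its columns, [s] is the basis built in [minor_basis] from the complement
    of [lset s], so only the sign of the determinant can change. *)
Lemma basis_minor s : bdet ext_mx s != 0 ->
  exists2 I : {set 'I_r}, #|I| = #|rset s| & minor_det A I (rset s) != 0 /\
    rval (minor_det A I (rset s)) = rval (bdet ext_mx s).
Proof.
move=> s0; have s_inj := bdet_neq0_inj s0.
have eI : #|(~: lset s)%SET| = #|rset s|.
  apply/eqP; rewrite -(eqn_add2l #|lset s|) cardsC card_lset //.
  by rewrite card_ord.
exists (~: lset s)%SET => //; have [s' [s'_inj ls rs <-]] := minor_basis eI.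
have [|p sp] := codom_perm s_inj s'_inj.
  move=> a; case: (split_ordP a) => k -> ka.
  - have : k \in lset s by rewrite inE.
    by rewrite -[lset s]finset.setCK -ls inE.
  - have : k \in rset s by rewrite inE.
    by rewrite -rs inE.
have e : bdet ext_mx s = (-1) ^+ p * bdet ext_mx s'.
  rewrite /bdet (_ : colsub s _ = col_perm p (colsub s' ext_mx)).
    by rewrite col_permE det_mulmx det_perm odd_permV mulrC.
  by apply/matrixP => i j; rewrite !mxE sp.
split; last by rewrite e rval_sign.
by apply: contraNneq s0 => b0; rewrite e b0 mulr0.
Qed.

Lemma entropy_le s : bdet ext_mx s != 0 ->
  (entropy_vector A (rset s) <= (rval (bdet ext_mx s))%:E)%E.
Proof.
move=> /basis_minor[I eI [m0 <-]]; apply: (@bigmin_inf _ _ _ _ I).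
  by rewrite eI.
by rewrite ((puiseux_valE _ m0).2 erefl).
Qed.

Lemma entropy_attained J : entropy_vector A J != +oo%E ->
  exists s, [/\ bdet ext_mx s != 0, rset s = J &
    entropy_vector A J = (rval (bdet ext_mx s))%:E].
Proof.
move=> hJ; have : entropy_vector A J = +oo%E \/
    exists2 I : {set 'I_r}, #|I| == #|J| & entropy_vector A J = puiseux_val (minor_det A I J).
  rewrite /entropy_vector; elim/big_rec: _ => [|I x eI IHx]; first by left.
  by rewrite minEle; case: ifP => _ //; right; exists I.
case=> [h|[I /eqP eI h]]; first by rewrite h in hJ.
have [s [s_inj _ rs bs]] := minor_basis eI.
have b0 : bdet ext_mx s != 0.
  by apply: contraNneq hJ; rewrite bs h => ->; rewrite /puiseux_val eqxx.
by exists s; rewrite h -bs; split => //; apply/puiseux_valE.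
Qed.

End ExtendedMatrix.

(** * The polyhedral complex of a function on subsets *)

Lemma affine_hull_add (R : realType) n d (S : set 'rV[R]_n) v (W : 'M[R]_(d, n)) c :
  S v -> (forall k, S (v + row k W)) -> affine_hull S (v + c *m W).
Proof.
(* The points [v + row k W] take the coefficients [c], and [v] takes what is missing to total
   [1]. *)
move=> Sv SW; exists (1 + d)%N, (row_mx (1 - \sum_i c 0 i)%:M c).
exists (col_mx v (const_mx 1 *m v + W)); split.
- move=> i; case: (split_ordP i) => k ->; first by rewrite rowKu row_id.
  rewrite rowKd; suff -> : row k (const_mx 1 *m v + W) = v + row k W by [].
  by apply/rowP => j; rewrite !mxE big_ord1 !mxE mul1r.
- rewrite big_split_ord /= big_ord1 row_mxEl mxE eqxx mulr1n.
  by under [X in _ + X]eq_bigr do rewrite row_mxEr; rewrite subrK.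
- rewrite mul_row_col mulmxDr mulmxA addrA mul_scalar_mx; congr (_ + _).
  suff -> : c *m const_mx 1 = (\sum_i c 0 i)%:M :> 'M_1.
    by rewrite mul_scalar_mx -scalerDl subrK scale1r.
  apply/matrixP => i j; rewrite !ord1 !mxE eqxx mulr1n.
  by apply: eq_bigr => k _; rewrite !mxE mulr1.
Qed.

Section SigmaComplex.
Variables (R : realType) (n : nat) (h : {set 'I_n} -> \bar R).
Hypothesis h_ninfty : forall J, h J != -oo%E.
Hypothesis h_finite : exists J, h J != +oo%E.
Implicit Types (J : {set 'I_n}) (v w y : 'rV[R]_n).

Definition set_sum v J : R := \sum_(j in J) v 0 j.

Lemma sigma_cellP J v : sigma_cell h J v <->
  exists2 a, h J = a%:E & forall J' a', h J' = a'%:E ->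
    set_sum v J' - a' <= set_sum v J - a.
Proof.
have max : sigma_cell h J v <-> forall J', (entropy_term h J' v <= entropy_term h J v)%E.
  split=> [<- J'|le]; first exact: le_bigmax.
  apply/le_anti; rewrite le_bigmax andbT; apply: bigmax_le => [|J' _]; rewrite ?leNye //.
split=> [/max le|[a hJ le]]; last first.
  apply/max => J'; rewrite /entropy_term hJ; have := h_ninfty J'.
  by case hJ' : (h J') => [a'||] // _; [rewrite -!EFinB lee_fin; apply: le|rewrite leNye].
have [J0 hJ0] := h_finite; have := le J0; have := h_ninfty J; have := h_ninfty J0.
rewrite /entropy_term; case hJ0' : (h J0) hJ0 => [a0||] // _ _.
case hJ : (h J) le => [a||] // le _ _; exists a => // J' a' hJ'.
by have := le J'; rewrite /entropy_term hJ hJ' -!EFinB lee_fin.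
Qed.

Lemma active_exists v : exists J, sigma_cell h J v.
Proof.
have [J0 hJ0] := h_finite.
have h_fine J : h J != +oo%E -> h J = (fine (h J))%:E.
  by move=> hJ; rewrite fineK // fin_numE hJ h_ninfty.
case: (@Order.TotalTheory.arg_maxP _ _ _ J0 (fun J => h J != +oo%E)
  (fun J => set_sum v J - fine (h J)) hJ0) => J /h_fine hJ le.
exists J; apply/sigma_cellP; exists (fine (h J)) => // J' a' hJ'.
by have := le J'; rewrite hJ' => /(_ isT).
Qed.

(* At each point of [sigma_cell h J] the cell contains a full orthant: moving the
   coordinates in [J] up and the others down keeps [J] optimal. *)
Lemma sigma_cell_maximal J v : sigma_cell h J v -> maximal_cell h J.
Proof.
move=> vJ; pose W : 'M[R]_n := diag_mx (\row_j (-1) ^+ (j \notin J)).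
have WW : W *m W = 1%:M.
  rewrite mulmx_diag -diag_const_mx; congr diag_mx; apply/rowP => j.
  by rewrite !mxE -signr_addb addbb.
exists 0, 1%:M; split; first by rewrite row_free_unit unitmx1.
apply/seteqP; split=> [w _|w _]; first by exists w; rewrite // add0r mulmx1.
have -> : w = v + ((w - v) *m W) *m W by rewrite -mulmxA WW mulmx1 subrKC.
apply: affine_hull_add => // k; move: vJ => /sigma_cellP[a hJ le].
apply/sigma_cellP; exists a => // J' a' /le.
have sumD J1 : set_sum (v + row k W) J1 = set_sum v J1 + (k \in J1)%:R * (-1) ^+ (k \notin J).
  transitivity (\sum_(j in J1) (v 0 j + row k W 0 j)).
    by apply: eq_bigr => j _; rewrite mxE.
  rewrite big_split /=; congr (_ + _); case: (boolP (k \in J1)) => kJ1.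
    rewrite (bigD1 k) //= big1 ?addr0 => [|j /andP[_ /negPf jk]]; rewrite !mxE.
      by rewrite eqxx mulr1n mul1r.
    by rewrite eq_sym jk mulr0n.
  rewrite mul0r big1 // => j jJ1; rewrite !mxE; case: eqP => [kj|]; last by rewrite mulr0n.
  by rewrite kj jJ1 in kJ1.
rewrite !sumD; case: (k \in J'); case: (k \in J) => /=; rewrite ?expr0 ?expr1; lra.
Qed.

(** The cell through [v] with the largest label, namely the union of all sets active at [v];
    [Sigma_supportP] only has to test this cell. *)
Definition min_cell v : set 'rV[R]_n :=
  [set w | forall J, sigma_cell h J v -> sigma_cell h J w].

(** The functional [u] sums the indicator differences of [J] and [J0] over the sets [J] active at
    [v]. On [sigma_cell h J0] each summand is at most [h J - h J0], and [v] attains all these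
    bounds. Every maximiser therefore attains them all, which puts it in every active cell. *)
Lemma min_cell_face J0 v : sigma_cell h J0 v -> face_of (sigma_cell h J0) (min_cell v).
Proof.
move=> vJ0; split; first by exists v.
pose act J := `[< sigma_cell h J v >].
pose u : 'rV[R]_n := \row_j \sum_(J | act J) ((j \in J)%:R - (j \in J0)%:R).
have dotE y : dotr u y = \sum_(J | act J) (set_sum y J - set_sum y J0).
  rewrite /dotr; under eq_bigr do rewrite mxE mulr_suml.
  rewrite exchange_big /=; apply: eq_bigr => J _.
  under eq_bigr do rewrite mulrBl; rewrite sumrB.
  by congr (_ - _); rewrite /set_sum [RHS]big_mkcond; apply: eq_bigr => j _;
    case: ifP; rewrite ?mul1r ?mul0r.
move: (vJ0) => /sigma_cellP[a0 hJ0 le0].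
pose a J := fine (h J).
have actE J : act J -> h J = (a J)%:E.
  by move=> /asboolP/sigma_cellP[b hJ _]; rewrite /a hJ.
have vE J : act J -> set_sum v J - set_sum v J0 = a J - a0.
  move=> aJ; have hJ := actE _ aJ; have := le0 _ _ hJ.
  move: aJ => /asboolP/sigma_cellP[b]; rewrite hJ => -[<-] /(_ _ _ hJ0); lra.
have leE y J : sigma_cell h J0 y -> act J -> set_sum y J - set_sum y J0 <= a J - a0.
  move=> /sigma_cellP[b]; rewrite hJ0 => -[<-] le aJ.
  by have := le _ _ (actE _ aJ); lra.
exists u; apply/seteqP; split=> x /=.
  move=> xv; split; first exact: xv.
  move=> y yJ0; rewrite !dotE; apply: ler_sum => J aJ.
  apply: le_trans (leE _ _ yJ0 aJ) _.
  move: aJ (actE _ aJ) => /asboolP/xv/sigma_cellP[b hJ /(_ _ _ hJ0)].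
  by rewrite hJ => + [<-]; lra.
move=> [xJ0 /(_ v vJ0)]; rewrite !dotE => le J /asboolP aJ.
have xE : set_sum x J - set_sum x J0 = a J - a0.
  apply/le_anti; rewrite leE //=; move: le.
  rewrite (bigD1 J) //= [leRHS](bigD1 J) //= -(vE _ aJ).
  suff : \sum_(J' | act J' && (J' != J)) (set_sum x J' - set_sum x J0) <=
         \sum_(J' | act J' && (J' != J)) (set_sum v J' - set_sum v J0) by lra.
  by apply: ler_sum => J' /andP[aJ' _]; rewrite vE // leE.
move: xJ0 => /sigma_cellP[b]; rewrite hJ0 => -[<-] lex.
apply/sigma_cellP; exists (a J); first exact: actE.
by move=> J' a' /lex; lra.
Qed.

Lemma min_cell_linearity v : linearity_complex h (min_cell v).
Proof.
have [J vJ] := active_exists v.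
by exists J; [exact: sigma_cell_maximal vJ|exact: min_cell_face].
Qed.

Lemma Sigma_min_cell v :
  (forall j : 'I_n, exists2 J : {set 'I_n}, j \in J & sigma_cell h J v) ->
  Sigma_complex h (min_cell v).
Proof.
move=> cov; split; first exact: min_cell_linearity.
apply/setP => j; rewrite finset.in_setT; have [J jJ vJ] := cov j.
apply/finset.bigcupP; exists J => //; apply/asboolP; split; first exact: sigma_cell_maximal vJ.
by move=> w; apply.
Qed.

Lemma Sigma_cell_cover tau : Sigma_complex h tau ->
  [/\ tau !=set0, exists J, tau `<=` sigma_cell h J &
  forall j : 'I_n, exists2 J : {set 'I_n}, j \in J & tau `<=` sigma_cell h J].
Proof.
move=> [[J0 _ [tau0 [u tauE]]] lab]; split=> //; first by exists J0; rewrite tauE => x [].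
move=> j; have : j \in cell_label h tau by rewrite lab finset.in_setT.
by move=> /finset.bigcupP[J /asboolP[_ sub] jJ]; exists J.
Qed.

Lemma Sigma_supportP v : complex_support (Sigma_complex h) v <->
  forall j : 'I_n, exists2 J : {set 'I_n}, j \in J & sigma_cell h J v.
Proof.
split=> [[tau /Sigma_cell_cover[_ _ cov] tv] j|cov].
  by have [J jJ /(_ v tv)] := cov j; exists J.
by exists (min_cell v); [exact: Sigma_min_cell|].
Qed.

End SigmaComplex.

(** * Lattice points and covering bases *)

Lemma exists_nonroot (F : numDomainType) (p : {poly F}) : p != 0 -> exists z, p.[z] != 0.
Proof.
move=> p0; apply: contrapT => np.
have := @max_poly_roots _ p [seq i%:R | i <- iota 0 (size p)] p0.
rewrite map_inj_uniq ?iota_uniq => [|i j /eqP]; last by rewrite eqr_nat => /eqP.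
rewrite size_map size_iota ltnn => H.
suff : false by []; apply: H => //; apply/allP => _ /mapP[i _ ->].
by apply: contrapT => pi; apply: np; exists i%:R; apply/negP.
Qed.

Section LatticeTropicalization.
Variables (R : realType) (r n : nat).
Local Notation K := (puiseux R[i]).
Variable A : 'M[K]_(r, n).
Local Notation E := (ext_mx A).
Local Notation h := (entropy_vector A).
Local Notation T := (bmx E).
Implicit Types (s : 'I_r -> 'I_(r + n)) (v : 'rV[R]_n) (J : {set 'I_n}).

Definition ext_optimal v s := optimal E (ext_weight v) s.
(** Membership of [v] in the support, expressed by matrix entries; [covering_support] and
    [support_covering] give the two directions. *)
Definition covering v s := ext_optimal v s /\
  forall j, exists k, tight E (ext_weight v) s k (rshift r j).

Lemma bdet_lshift : bdet E (lshift n) = 1.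
Proof.
rewrite /bdet (_ : colsub _ _ = 1%:M) ?det1 //.
by apply/matrixP => i j; rewrite mxE row_mxEl.
Qed.

Lemma entropy_neq_ninfty J : h J != -oo%E.
Proof.
rewrite /entropy_vector; elim/big_rec: _ => // I x _ xn.
by rewrite minEle; case: ifP => // _; rewrite /puiseux_val; case: ifP.
Qed.

Lemma entropy_neq_pinfty : exists J, h J != +oo%E.
Proof.
have b0 : bdet E (lshift n) != 0 by rewrite bdet_lshift oner_neq0.
have := entropy_le b0; set J := rset _ => le; by exists J; case: (h J) le.
Qed.

Lemma ext_optimal_exists v : exists s, ext_optimal v s.
Proof.
have [|s [s0 _ os]] := @minimal_basis _ _ _ E predT (ext_weight v).
  by exists (lshift n); rewrite // bdet_lshift oner_neq0.
by exists s; split => // k a; apply: os.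
Qed.

(** A basis attaining the minimum [h J] does not depend on [v], so one [s] serves the whole cell. *)
Lemma sigma_cell_basis J : h J != +oo%E ->
  exists s, [/\ bdet E s != 0, rset s = J &
    forall v, sigma_cell h J v -> ext_optimal v s].
Proof.
move=> /entropy_attained[s [s0 rs hJ]]; exists s; split => // v.
move=> /(sigma_cellP entropy_neq_ninfty entropy_neq_pinfty)[a]; rewrite hJ => -[<-] le.
split => // k a'; apply: vge_bmx => // s'0.
have := entropy_le s'0; have := entropy_neq_ninfty (rset (subst_col s k a')).
case h' : (h _) => [b||] // _; rewrite lee_fin => bl.
have := le _ _ h'; rewrite /set_sum -rs -!weight_rset.
- by move: bl; rlra.
- exact: bdet_neq0_inj s0.
- exact: bdet_neq0_inj s'0.
Qed.

Lemma ext_optimal_cell v s : ext_optimal v s -> sigma_cell h (rset s) v.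
Proof.
move=> os; have s0 := os.1; have le_s := entropy_le s0.
have [|s1 [_ _ h1]] := @entropy_attained _ _ _ A (rset s).
  by move: le_s; case: (h _).
apply/(sigma_cellP entropy_neq_ninfty entropy_neq_pinfty).
exists (rval (bdet E s1)) => // J' a' hJ'.
have [|s' [s'0 rs' h'J']] := @entropy_attained _ _ _ A J'; first by rewrite hJ'.
move: le_s; rewrite h1 lee_fin => le_s.
have := optimal_le os s'0; rewrite !weight_rset ?rs' /set_sum.
- by move: h'J'; rewrite hJ' => -[->]; move: le_s; rlra.
- exact: bdet_neq0_inj s'0.
- exact: bdet_neq0_inj s0.
Qed.

Lemma rsetP s j : reflect (exists i, s i = rshift r j) (j \in rset s).
Proof. by rewrite inE; apply: (iffP codomP) => -[i si]; exists i. Qed.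

(** Exchanging column [j] into [s] at its tight entry gives another optimal basis, hence an active
    set containing [j]. *)
Lemma covering_support v s : covering v s -> complex_support (Sigma_complex h) v.
Proof.
move=> [os cov]; apply/(Sigma_supportP entropy_neq_ninfty entropy_neq_pinfty) => j.
have [k tk] := cov j; exists (rset (subst_col s k (rshift r j))).
  by apply/rsetP; exists k; rewrite /subst_col eqxx.
by apply: ext_optimal_cell; apply: optimal_subst.
Qed.

(** The bases for one active set and for another one containing [j] are fixed for the whole cell.
    Since the permutation of [optimal_exchange] is independent of [v], the position [k] of the tight
    entry is constant on [tau]. *)
Lemma Sigma_cell_basis tau : Sigma_complex h tau ->
  exists s, (forall v, tau v -> ext_optimal v s) /\
    forall j, exists k, forall v, tau v -> tight E (ext_weight v) s k (rshift r j).
Proof.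
move=> /Sigma_cell_cover[[v0 v0t] [J0 sub0] cov].
have fin J : tau `<=` sigma_cell h J -> h J != +oo%E.
  by move=> /(_ v0 v0t)/(sigma_cellP entropy_neq_ninfty entropy_neq_pinfty)[a ->].
have [s [s0 _ os]] := sigma_cell_basis (fin _ sub0).
exists s; split=> [v /sub0/os //|j]; have [J jJ sub] := cov j.
have [s' [s'0 rs' os']] := sigma_cell_basis (fin _ sub).
have [p tp] := optimal_exchange s0 s'0.
move: jJ; rewrite -rs' => /rsetP[i <-]; exists (p i) => v tv.
by apply: tp; [apply/os/sub0|apply/os'/sub].
Qed.

Lemma support_covering v : complex_support (Sigma_complex h) v -> exists s, covering v s.
Proof.
move=> [tau /Sigma_cell_basis[s [os cov]] tv]; exists s; split; first exact: os.
by move=> j; have [k /(_ v tv)] := cov j; exists k.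
Qed.

Lemma mul_ext_mx p (c : 'M[K]_(p, r)) : c *m E = row_mx c (c *m A).
Proof. by rewrite mul_mx_row mulmx1. Qed.

Lemma mul_bmx_ext s p (c : 'M[K]_(p, r)) : bdet E s != 0 ->
  colsub s (row_mx c (c *m A)) *m T s = row_mx c (c *m A).
Proof. by move=> s0; rewrite -mul_ext_mx colsub_mul -mulmxA mul_bmx. Qed.

(** In the rows of [T s] the vector [row_mx c (c *m A)] has coefficients [d], of valuations at least
    the weights. A term of coordinate [j] with valuation at most [v 0 j] then meets both lower
    bounds, for [d] and for [T s], with equality. *)
Lemma trop_covering v s (c : 'rV[K]_r) : ext_optimal v s ->
  (forall i, vge 0 (c 0 i)) ->
  (forall j, (c *m A) 0 j != 0 /\ rval ((c *m A) 0 j) = v 0 j) -> covering v s.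
Proof.
move=> os c0 xv; split => // j; have [xj0 xjv] := xv j; have s0 := os.1.
pose d := colsub s (row_mx c (c *m A)).
have dge k : vge (ext_weight v (s k)) (d 0 k).
  rewrite mxE; case: (split_ordP (s k)) => i ->.
    by rewrite ext_weightl row_mxEl; apply: c0.
  by rewrite ext_weightr row_mxEr; apply/(vgeE _ (xv i).1); rewrite (xv i).2.
have xE : (c *m A) 0 j = \sum_k d 0 k * T s k (rshift r j).
  by have /matrixP/(_ 0 (rshift r j)) := mul_bmx_ext c s0; rewrite row_mxEr mxE.
move: (xj0); rewrite xE => /rval_sum_witness[k [_ dT0]]; rewrite -xE xjv.
move: (dT0); rewrite mulf_eq0 negb_or => /andP[d0 T0]; rewrite rvalM // => le.
exists k; split => //; rewrite ext_weightr.
have := (vgeE _ d0).1 (dge k); have := (vgeE _ T0).1 (os.2 k (rshift r j)).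
by rewrite ext_weightr; move: le; rlra.
Qed.

Lemma covering_trop v s : covering v s -> rational_points v ->
  trop_set (lattice_span A) v.
Proof.
move=> [os cov] /choice[q vq]; have s0 := os.1.
pose qe (a : 'I_(r + n)) : rat := match fintype.split a with inl _ => 0 | inr j => q j end.
have qeE a : ext_weight v a = ratr (qe a).
  by rewrite /ext_weight /qe; case: fintype.split => [_|j]; rewrite ?rmorph0.
(* The value of [P j] at [z] will be the coefficient at exponent [q j] of the [j]-th coordinate of
   the lattice point. The polynomial is nonzero because the tight entry contributes its leading
   coefficient. *)
pose P j : {poly R[i]} := \poly_(k < r) 
  (if insub k is Some k' then T s k' (rshift r j) (q j - qe (s k')) else 0).
have P0 j : P j != 0.
  have [k [Tk0 Tke]] := cov j; apply/eqP => /(congr1 (fun p : {poly _} => p`_k)).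
  rewrite coef_poly ltn_ord valK coef0; apply/eqP.
  have -> : q j - qe (s k) = min_exponent (T s k (rshift r j)).
    have : ratr (q j - qe (s k)) = rval (T s k (rshift r j)) :> R.
      by rewrite Tke rmorphB /= -qeE -vq ext_weightr.
    by move=> /fmorph_inj.
  exact: (min_exponentP Tk0).1.
have [z] : exists z, (\prod_j P j).[z] != 0.
  by apply: exists_nonroot; apply/prodf_neq0 => j _.
rewrite horner_prod => /prodf_neq0 Pz.
pose d : 'rV[K]_r := \row_k monom (z ^+ k) (qe (s k)).
pose c := d *m invmx (colsub s E).
have cE : row_mx c (c *m A) = d *m T s by rewrite -mul_ext_mx /c -mulmxA.
(* At right indices this bounds the valuations below by [v]. At left indices, of weight zero, it
   makes [c] integral, so that [c *m A] is in the lattice. *)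
have cEge a : vge (ext_weight v a) ((row_mx c (c *m A)) 0 a).
  rewrite cE mxE; apply: vge_sum => k _; rewrite mxE.
  apply: vge_le _ (vgeM (@vge_monom R _ _) (os.2 k a)).
  by rewrite -qeE addrC subrK.
exists (c *m A).
  exists c => // i; apply/puiseux_val_ge0; have := cEge (lshift n i).
  by rewrite ext_weightl row_mxEl.
move=> j; have := cEge (rshift r j); rewrite ext_weightr row_mxEr => ge.
have coef0 : ((c *m A) 0 j) (q j) != 0.
  suff -> : ((c *m A) 0 j) (q j) = (P j).[z] by apply: Pz.
  have /matrixP/(_ 0 (rshift r j)) := cE; rewrite row_mxEr [RHS]mxE => ->.
  rewrite puiseux_coef_sum horner_poly; apply: eq_bigr => k _.
  have -> : d 0 k = monom (z ^+ k) (qe (s k)) by rewrite mxE.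
  by rewrite valK monom_coef mulrC.
have x0 : (c *m A) 0 j != 0 by apply: contraNneq coef0 => ->.
split => //; apply/puiseux_valE => //; apply/le_anti; rewrite (vgeE _ x0).1 // andbT vq.
exact: rval_min.
Qed.

(** A tight row of [T s] is expanded in the rows of [T s']. The translation raises right weights by
    [c] and left weights not at all, hence every weight by at most [c], and this forces a term of
    the expansion to be tight for [s']. *)
Lemma covering_shift v s s' (c : R) : covering v s -> 0 <= c ->
  ext_optimal (v + c *: const_mx 1) s' -> covering (v + c *: const_mx 1) s'.
Proof.
move=> [[s0 os] cov] c0 os'; split => // j; have [k [T0 Te]] := cov j.
have s'0 := os'.1; set w := ext_weight _ in os' *.
have wv a : w a <= ext_weight v a + c.
  rewrite /w; case: (split_ordP a) => i ->; first by rewrite !ext_weightl add0r.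
  by rewrite !ext_weightr !mxE mulr1.
have TE : T s k (rshift r j) = \sum_l T s k (s' l) * T s' l (rshift r j).
  rewrite {1}(bmx_trans _ s'0) mxE; apply: eq_bigr => l _.
  by rewrite [colsub _ _ _ _]mxE.
move: (T0); rewrite TE => /rval_sum_witness[l [_ TT0]]; rewrite -TE Te.
move: (TT0); rewrite mulf_eq0 negb_or => /andP[Tk0 Tl0]; rewrite rvalM // => le.
exists l; split => //.
have := (vgeE _ Tk0).1 (os k (s' l)); have := (vgeE _ Tl0).1 (os'.2 l (rshift r j)).
have := wv (s' l); have : w (rshift r j) = ext_weight v (rshift r j) + c.
  by rewrite /w !ext_weightr !mxE mulr1.
by move: le; rewrite -/w; rlra.
Qed.

End LatticeTropicalization.

(** * Rational perturbation and closed sets of row vectors *)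

Lemma fin_nat_bound (R : realType) (I : finType) (f : I -> R) :
  exists N : nat, forall i, f i <= N%:R.
Proof.
exists (Num.bound (\sum_i `|f i|)) => i; apply: le_trans (ler_norm _) _.
have s0 : 0 <= \sum_i `|f i| by apply: sumr_ge0.
apply: le_trans (ltW (archi_boundP s0)); rewrite (bigD1 i) //= lerDl.
exact: sumr_ge0.
Qed.

Lemma fin_pos_bound (R : realType) (I : finType) (f : I -> R) :
  (forall i, 0 < f i) -> exists2 e, 0 < e & forall i, e <= f i.
Proof.
move=> f0; exists (\big[Num.min/1]_i f i); last by move=> i; apply: bigmin_le.
by elim/big_ind: _ => // x y x0 y0; rewrite lt_min x0.
Qed.

(* A perturbation of the reals into [rat] that is constant on classes modulo [rat],
   so that it preserves every equation [x - y = q] with [q] rational. *)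
Lemma rational_perturbation (R : realType) (e : R) : 0 < e ->
  exists d : R -> R, [/\ forall x, `|d x| < e, forall x, exists q, x + d x = ratr q,
    forall x q, d (x + ratr q) = d x & d 0 = 0].
Proof.
(* Rational numbers are not moved by [d0]. The class of [0] has a rational representative, so
   [d 0 = 0], and the zero weights of the left block will stay in place. *)
move=> e0; have /choice[d0 d0P] : forall y : R, exists d : R, [/\ `|d| < e,
    exists q, y + d = ratr q & (exists q, y = ratr q) -> d = 0].
  move=> y; have [[q ->]|nq] := pselect (exists q, y = ratr q).
    by exists 0; split => //; [rewrite normr0|exists q; rewrite addr0].
  have [|q] := @rat_in_itvoo R (y - e) (y + e); first by lra.
  rewrite in_itv /= => qy; exists (ratr q - y); split => //.
    by rewrite ltr_norml; apply/andP; split; lra.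
  by exists q; rewrite subrKC.
pose cl (x : R) := [set y : R | exists q, x = y + ratr q].
pose rep x := xget 0 (cl x).
have repP x : exists q, x = rep x + ratr q.
  by apply: (@xgetPex _ 0 (cl x)); exists x, 0; rewrite rmorph0 addr0.
exists (d0 \o rep); split => [x|x|x q|] /=.
- by have [] := d0P (rep x).
- have [q xE] := repP x; have [_ [p pE] _] := d0P (rep x).
  by exists (p + q); rewrite {1}xE rmorphD /= -pE addrAC.
- congr (d0 (xget _ _)); apply/seteqP; split=> y [p yE].
    by exists (p - q); rewrite rmorphB /=; lra.
  by exists (p + q); rewrite rmorphD /=; lra.
- have [_ _] := d0P (rep 0); apply; have [q qE] := repP 0.
  by exists (- q); rewrite rmorphN /=; lra.
Qed.

Lemma closed_ext (T : topologicalType) (B C : set T) :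
  (forall x, C x <-> B x) -> closed B -> closed C.
Proof. by move=> BC; have -> : C = B by apply/seteqP; split => x /BC. Qed.

Section RowTopology.
Variables (R : realType) (n : nat).
Implicit Types v w : 'rV[R]_n.

Lemma nbhs_rowP v (U : set 'rV[R]_n) : nbhs v U <->
  exists2 e : R, 0 < e & forall w, (forall j, `|v 0 j - w 0 j| < e) -> U w.
Proof.
split=> [/nbhs_ballP[e e0 sub]|[e e0 sub]].
  by exists e => // w vw; apply: sub; split=> // i j; rewrite !ord1; apply: vw.
apply/nbhs_ballP; exists e => // w [_ vw]; apply: sub => j; exact: vw.
Qed.

Lemma closed_coordB_le j k (a : R) : closed [set v : 'rV[R]_n | v 0 j - v 0 k <= a].
Proof.
move=> v cl; rewrite /= leNgt; apply/negP => va.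
have [|w /= [wa vw]] := cl [set w | forall i, `|v 0 i - w 0 i| < (v 0 j - v 0 k - a) / 2%:R].
  by apply/nbhs_rowP; exists ((v 0 j - v 0 k - a) / 2%:R) => //; lra.
by have := vw j; have := vw k; rewrite !ltr_norml => /andP[? ?] /andP[? ?]; lra.
Qed.

Lemma closed_coordB_eq j k (a : R) : closed [set v : 'rV[R]_n | a = v 0 j - v 0 k].
Proof.
apply: closed_ext (closedI (closed_coordB_le (j:=j) (k:=k) (a:=a))
  (closed_coordB_le (j:=k) (k:=j) (a:=- a))) => v.
by split=> [/= ->|/= [? ?]]; [split; lra|lra].
Qed.

End RowTopology.

(** * The tropical linear space *)

Section TropicalLinearSpace.
Variables (R : realType) (r n : nat).
Local Notation K := (puiseux R[i]).
Variable A : 'M[K]_(r, n).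
Local Notation E := (ext_mx A).
Local Notation h := (entropy_vector A).
Local Notation T := (bmx E).
Local Notation L := (lattice_span A).
Local Notation rcol g := (fun k : 'I_r => rshift r (g k)).
Implicit Types (s : 'I_r -> 'I_(r + n)) (v : 'rV[R]_n) (g : 'I_r -> 'I_n).

(** Tight entries relate weights that differ by a rational number, so they stay tight under a
    perturbation constant on classes modulo [rat]. The other inequalities are strict and survive a
    small perturbation. *)
Lemma covering_perturb v s (e : R) : 0 < e -> covering A v s ->
  exists v', [/\ rational_points v', forall j, `|v 0 j - v' 0 j| < e & covering A v' s].
Proof.
move=> e0 [[s0 os] cov]; pose w : 'I_(r + n) -> R := ext_weight v.
pose slack (ka : 'I_r * 'I_(r + n)) := rval (T s ka.1 ka.2) - (w ka.2 - w (s ka.1)).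
have [|e1 e10 e1P] := @fin_pos_bound _ _ (fun ka => if 0 < slack ka then slack ka else 1).
  by move=> ka; case: ifP.
(* Two weights enter each inequality, and each moves by less than [e1 / 2]. *)
have [|d [dlt dq dinv d0]] := @rational_perturbation R (Num.min e (e1 / 2%:R)).
  by rewrite lt_min e0 divr_gt0.
pose v' : 'rV[R]_n := \row_j (v 0 j + d (v 0 j)).
have v'E a : ext_weight v' a = w a + d (w a).
  rewrite /w; case: (split_ordP a) => i ->; first by rewrite !ext_weightl d0 addr0.
  by rewrite !ext_weightr mxE.
have tv' k a : tight E w s k a -> tight E (ext_weight v') s k a.
  move=> [T0 Te]; split => //; rewrite !v'E Te.
  have -> : w a = w (s k) + ratr (min_exponent (T s k a)).
    by rewrite -[ratr _]/(rval _) Te subrKC.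
  by rewrite dinv; lra.
exists v'; split.
- by move=> j; have [q qE] := dq (v 0 j); exists q; rewrite mxE.
- move=> j; rewrite mxE opprD addNKr normrN; apply: lt_le_trans (dlt _) _.
  by rewrite ge_min lexx.
split; last by move=> j; have [k /tv'] := cov j; exists k.
split => // k a; have [->|T0] := eqVneq (T s k a) 0; first exact: vge0.
have := (vgeE _ T0).1 (os k a); rewrite le_eqVlt => /orP[/eqP Te|lt].
  by apply/(vgeE _ T0); rewrite (tv' k a _).2 //; split.
have := e1P (k, a); rewrite /slack /= subr_gt0 lt => le1.
have := dlt (w a); have := dlt (w (s k)).
rewrite !lt_min !ltr_norml => /andP[_ /andP[? ?]] /andP[_ /andP[? ?]].
by apply/(vgeE _ T0); rewrite !v'E; move: le1; rlra.
Qed.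

(* The bases made of columns of [A] only: their tightness conditions are invariant
   under translation of [v] by [R 1]. *)
Definition linear_covering v g : Prop :=
  [/\ bdet E (rcol g) != 0,
      forall k j, vge (v 0 j - v 0 (g k)) (T (rcol g) k (rshift r j)) &
      forall j, exists k, T (rcol g) k (rshift r j) != 0 /\
        rval (T (rcol g) k (rshift r j)) = v 0 j - v 0 (g k)].

Lemma shift_coord v (c : R) j : (v + c *: const_mx 1) 0 j = v 0 j + c.
Proof. by rewrite !mxE mulr1. Qed.

(** A large translation makes the conditions at the left columns hold, since their weight stays
    zero, and does not change those at the right columns. *)
Lemma right_basis_optimal v g : bdet E (rcol g) != 0 ->
  (forall k j, vge (v 0 j - v 0 (g k)) (T (rcol g) k (rshift r j))) ->
  exists N : nat, forall c, N%:R <= c -> ext_optimal A (v + c *: const_mx 1) (rcol g).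
Proof.
move=> s0 os; have [N NP] := @fin_nat_bound R ('I_r * 'I_r)%type
  (fun ki => - v 0 (g ki.1) - rval (T (rcol g) ki.1 (lshift n ki.2))).
exists N => c Nc; split => // k a /=; case: (split_ordP a) => i ->; last first.
  by rewrite !ext_weightr !shift_coord; have := os k i; congr vge; lra.
rewrite ext_weightl ext_weightr shift_coord.
have [->|T0] := eqVneq (T (rcol g) k (lshift n i)) 0; first exact: vge0.
by apply/(vgeE _ T0); have := NP (k, i) => /=; move: Nc; rlra.
Qed.

Lemma linear_covering_support v g : linear_covering v g ->
  exists c : R, complex_support (Sigma_complex h) (v + c *: const_mx 1).
Proof.
move=> [s0 os cov]; have [N NP] := right_basis_optimal s0 os.
exists N%:R; apply: (@covering_support _ _ _ _ _ (rcol g)); split; first exact: NP.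
move=> j; have [k [T0 Te]] := cov j; exists k; split => //.
by rewrite /= !ext_weightr !shift_coord Te; lra.
Qed.

Lemma right_basis_exists : row_free A -> exists g, bdet E (rcol g) != 0.
Proof.
move=> fA; have fT : row_full A^T by rewrite /row_full mxrank_tr.
exists (fullrankfun fT); have := fullrowsub_unit fT.
rewrite -unitmx_tr unitmxE unitfE; congr (\det _ != 0).
by apply/matrixP => i j; rewrite !mxE /= (unsplitK (inr _)).
Qed.

(** An optimal basis among the columns of [A] becomes optimal for the whole extended matrix after a
    large translation. There [covering_shift] supplies its tight entries, and tightness between
    right columns is invariant under translation. *)
Lemma support_linear_covering v (c : R) : row_free A ->
  complex_support (Sigma_complex h) (v + c *: const_mx 1) ->
  exists g, linear_covering v g.
Proof.
move=> /right_basis_exists[g0 g00] /support_covering[s cov].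
pose Q (a : 'I_(r + n)) := [exists j, a == rshift r j].
have [|s' [s'0 Qs' os']] := @minimal_basis _ _ _ E Q (ext_weight v).
  by exists (rcol g0) => // i; apply/existsP; exists (g0 i).
have /choice[g gE] : forall i, exists j, s' i = rshift r j.
  by move=> i; have /existsP[j /eqP ->] := Qs' i; exists j.
have s'E : s' = rcol g by apply/funext.
rewrite s'E in s'0 os'; exists g.
have os k j : vge (v 0 j - v 0 (g k)) (T (rcol g) k (rshift r j)).
  have := os' k (rshift r j); rewrite /= !ext_weightr; apply.
  by apply/existsP; exists j.
split => //; have [N NP] := right_basis_optimal s'0 os.
(* The added translation is nonnegative, and the total one, [c + (N + |c|)], is at least [N]. *)
have := @covering_shift _ _ _ _ _ s (rcol g) (N%:R + `|c|) cov.
rewrite -addrA -scalerDl => /(_ _ _)[||_ cov' j].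
- by rewrite addr_ge0.
- by apply: NP; have := ler_norm (- c); rewrite normrN; lra.
have [k [T0 Te]] := cov' j; exists k; split => //.
by rewrite Te /= !ext_weightr !shift_coord; lra.
Qed.

(** The set is a union over the maps [g], taken as finite functions so that the union is finite, of
    sets cut out by comparing coordinate differences with constants. *)
Lemma closed_linear_covering : closed [set v | exists g, linear_covering v g].
Proof.
pose s g := rcol g; pose V := 'rV[R]_n.
pose Ge (g : 'I_r -> 'I_n) k j := [set v : V | vge (v 0 j - v 0 (g k)) (T (s g) k (rshift r j))].
pose Eq (g : 'I_r -> 'I_n) k j := [set v : V | T (s g) k (rshift r j) != 0 /\
  rval (T (s g) k (rshift r j)) = v 0 j - v 0 (g k)].
have cGe g k j : closed (Ge g k j).
  have [T0|T0] := eqVneq (T (s g) k (rshift r j)) 0.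
    apply: (@closed_ext _ setT) => [v|]; last exact: closedT.
    by split=> // _; rewrite /Ge /= T0; apply: vge0.
  apply: (@closed_ext _ _ _ _
    (@closed_coordB_le _ _ j (g k) (rval (T (s g) k (rshift r j))))) => v.
  exact: vgeE.
have cEq g k j : closed (Eq g k j).
  have [T0|T0] := eqVneq (T (s g) k (rshift r j)) 0.
    by apply: (@closed_ext _ set0) => [v|]; [split=> // -[]; rewrite T0 eqxx|exact: closed0].
  apply: (@closed_ext _ _ _ _
    (@closed_coordB_eq _ _ j (g k) (rval (T (s g) k (rshift r j))))) => v.
  by split=> [[]|].
apply: (@closed_ext _ (\bigcup_(g in [set g : {ffun 'I_r -> 'I_n} | bdet E (s g) != 0])
  ((\bigcap_(kj in [set: 'I_r * 'I_n]) Ge g kj.1 kj.2) `&`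
   \bigcap_(j in [set: 'I_n]) \bigcup_(k in [set: 'I_r]) Eq g k j))).
  move=> v; split=> [[g [s0 os cov]]|[g /= s0 [os cov]]]; last first.
    exists g; split => // [k j|j]; first exact: (os (k, j)).
    by have [k _ Tk] := cov j I; exists k.
  have gE : finfun g = g :> ('I_r -> 'I_n) by apply/funext => i; rewrite ffunE.
  exists (finfun g); rewrite /= gE //; split=> [[k j] _|j _]; first exact: os.
  by have [k Tk] := cov j; exists k.
apply: closed_bigcup => [|g _]; first exact: finite_finset.
apply: closedI; first by apply: closed_bigI.
by apply: closed_bigI => j _; apply: closed_bigcup => [|k _]; [exact: finite_finset|].
Qed.

Lemma torus_projP v w : @torus_proj R n v = torus_proj w <->
  exists c : R, v = w + c *: const_mx 1.
Proof.
split=> [/eqmodP/asboolP //|vw]; apply/eqmodP; exact/asboolP.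
Qed.

Lemma KspanP (x : 'rV[K]_n) : Kspan L x <-> exists c : 'rV[K]_r, x = c *m A.
Proof.
split=> [[m [c [B [BL ->]]]]|[c ->]].
  have /choice[D DE] : forall i, exists d : 'rV[K]_r, row i B = d *m A.
    by move=> i; have [d _ <-] := BL i; exists d.
  exists (c *m (\matrix_i D i)); rewrite -mulmxA; congr (_ *m _).
  by apply/row_matrixP => i; rewrite DE row_mul rowK.
exists r, c, A; split => // i; exists (delta_mx 0 i); last by rewrite -rowE.
move=> j; apply/puiseux_val_ge0; rewrite mxE eqxx; case: eqP => _ /=; last exact: vge0.
by apply/vgeE; rewrite ?oner_neq0 // rval1.
Qed.

Lemma trop_Kspan v : trop_set (Kspan L) v ->
  exists c : R, complex_support (Sigma_complex h) (v + c *: const_mx 1).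
Proof.
move=> [x /KspanP[c ->] xv].
have [N NP] := @fin_nat_bound R 'I_r (fun i => - rval (c 0 i)).
(* The factor [t^N] makes the coefficients integral and raises all valuations by [N]. *)
pose m : K := monom 1 N%:R; have m0 : m != 0 by apply: monom_neq0.
have rm : rval m = N%:R by rewrite rval_monom ratr_nat.
exists N%:R; have [s os] := ext_optimal_exists A (v + N%:R *: const_mx 1).
apply: (@covering_support _ _ _ _ _ s); apply: (trop_covering (c := m *: c)) => //.
  move=> i; rewrite mxE; have [->|c0] := eqVneq (c 0 i) 0; first by rewrite mulr0; apply: vge0.
  apply/vgeE; first by rewrite mulf_neq0.
  by rewrite rvalM // rm -lerBlDr sub0r; apply: NP.
move=> j; have [x0 /(puiseux_valE _ x0) xe] := xv j.
rewrite -scalemxAl mxE shift_coord; split; first by rewrite mulf_neq0.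
by rewrite rvalM // rm xe addrC.
Qed.

(** The image is closed, because its preimage is described by [linear_covering], and it contains the
    tropicalization of the span. Conversely, covered points are approximated by rational covered
    points, which come from lattice points. *)
Lemma torus_proj_support : row_free A ->
  @torus_proj R n @` complex_support (Sigma_complex h) = trop_linear_space (Kspan L).
Proof.
move=> fA; set D := _ @` _.
have DE v : D (torus_proj v) <-> exists c : R,
    complex_support (Sigma_complex h) (v + c *: const_mx 1).
  split=> [[w wS /esym/torus_projP[c vE]]|[c cS]].
    by exists (- c); rewrite vE scaleNr addrK.
  by exists (v + c *: const_mx 1) => //; apply/torus_projP; exists c.
have clD : closed D.
  rewrite -openC /open /= /quotient_open.
  rewrite (_ : _ @^-1` _ = ~` [set v | exists g, linear_covering v g]).
    by rewrite openC; apply: closed_linear_covering.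
  apply/seteqP; split => v nv nw; apply: nv.
    by have [g /linear_covering_support/DE] := nw.
  by move/DE: nw => [c]; apply: support_linear_covering.
apply/seteqP; split; last first.
  apply: subset_trans clD; apply: closure_subset => _ [v vT <-]; apply/DE; exact: trop_Kspan.
move=> _ [v /support_covering[s cov] <-] B Bv.
have /nbhs_rowP[e e0 sub] : nbhs v (@torus_proj R n @^-1` B).
  by have := @pi_continuous _ _ v B Bv; apply.
have [v' [rv' vv' cov']] := covering_perturb e0 cov.
exists (torus_proj v'); split; last exact: sub.
exists v' => //; have [x [c _ <-] xv] := covering_trop cov' rv'.
by exists (c *m A) => //; apply/KspanP; exists c.
Qed.

End TropicalLinearSpace.

(** * Dimensions of affine hulls *)

Lemma mul_select (F : pzSemiRingType) d n (u : 'rV[F]_d) (f : 'I_n -> 'I_d) j :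
  (u *m \matrix_(k, l) (k == f l)%:R) 0 j = u 0 (f j).
Proof.
rewrite mxE (bigD1 (f j)) //= mxE eqxx mulr1 big1 ?addr0 // => i /negPf ij.
by rewrite mxE ij mulr0.
Qed.

Section AffineDimension.
Variables (R : realType) (n : nat) (S : set 'rV[R]_n).
Variables (d : nat) (q : 'rV[R]_n) (W : 'M[R]_(d, n)).
Hypothesis S_sub : forall v, S v -> exists u : 'rV[R]_d, v = q + u *m W.

Lemma affine_hull_sub v : affine_hull S v -> exists u : 'rV[R]_d, v = q + u *m W.
Proof.
move=> [m [c [B [BS c1 ->]]]].
have /choice[U UE] : forall i, exists u : 'rV[R]_d, row i B = q + u *m W.
  by move=> i; apply: S_sub.
exists (c *m \matrix_i U i); rewrite -mulmxA.
have -> : B = const_mx 1 *m q + (\matrix_i U i) *m W.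
  apply/row_matrixP => i; rewrite UE linearD /= !row_mul rowK; congr (_ + _).
  by apply/rowP => j; rewrite !mxE big_ord1 !mxE mul1r.
rewrite mulmxDr !mulmxA; congr (_ + _).
have -> : c *m const_mx 1 = 1%:M :> 'M_1.
  apply/matrixP => i j; rewrite !ord1 !mxE eqxx -[RHS]c1.
  by apply: eq_bigr => k _; rewrite !mxE mulr1.
by rewrite mul1mx.
Qed.

Lemma rows_submx k (x : 'rV[R]_n) (W' : 'M[R]_(k, n)) :
  affine_hull S x -> (forall i, affine_hull S (x + row i W')) -> (W' <= W)%MS.
Proof.
move=> /affine_hull_sub[u0 xE] WS; apply/row_subP => i.
have [u uE] := affine_hull_sub (WS i).
have -> : row i W' = (u - u0) *m W.
  by rewrite mulmxBl -(addKr x (row i W')) uE xE opprD addrACA addNr add0r addrC.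
exact: submxMl.
Qed.

Lemma has_dim_le k : has_dim S k -> (k <= d)%N.
Proof.
move=> [x [W' [/eqP rW' hullE]]]; rewrite -rW'.
apply: leq_trans (rank_leq_row W); apply/mxrankS/(rows_submx (x := x)).
  by rewrite hullE; exists 0; rewrite // mul0mx addr0.
by move=> i; rewrite hullE; exists (delta_mx 0 i); rewrite // -rowE.
Qed.

Lemma sub_affine_hull v : S v -> affine_hull S v.
Proof.
move=> Sv; exists 1%N, 1%:M, v; split; first by move=> i; rewrite row_id.
  by rewrite big_ord1 mxE eqxx.
by rewrite mul1mx.
Qed.

(** By [S_sub] the hull has at most [d] parameters, while the given points of [S] provide [d]
    independent directions; comparing ranks, [W] and [W'] have the same row space. *)
Lemma has_dim_eq x (W' : 'M[R]_(d, n)) : row_free W' -> S x ->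
  (forall k, S (x + row k W')) -> has_dim S d.
Proof.
move=> fW' Sx SW'; exists x, W'; split => //.
have W'W : (W' <= W)%MS.
  by apply: (rows_submx (x := x)) => [|i]; apply: sub_affine_hull.
have WW' : (W <= W')%MS.
  by rewrite -(mxrank_leqif_sup W'W) eqn_leq mxrankS // (eqP fW') rank_leq_row.
apply/seteqP; split=> [v /affine_hull_sub[u vE]|_ [c _ <-]]; last exact: affine_hull_add.
have [u0 xE] := S_sub Sx.
have : (v - x <= W')%MS.
  apply: submx_trans WW'; rewrite vE xE opprD addrACA subrr add0r -mulmxBl.
  exact: submxMl.
by move=> /submxP[c cE]; exists c; rewrite // -cE subrKC.
Qed.

End AffineDimension.

(** * Dimension of the complex *)

Section SigmaDimension.
Variables (R : realType) (r n : nat).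
Local Notation K := (puiseux R[i]).
Variable A : 'M[K]_(r, n).
Local Notation E := (ext_mx A).
Local Notation h := (entropy_vector A).
Local Notation T := (bmx E).

(** The position of the tight entry in column [j] is constant on the cell, so each coordinate is a
    constant plus one of the [r] weights of the basis. *)
Lemma Sigma_cell_affine tau : Sigma_complex h tau ->
  exists q (W : 'M[R]_(r, n)), forall v, tau v -> exists u : 'rV[R]_r, v = q + u *m W.
Proof.
move=> /Sigma_cell_basis[s [_ /choice[k tk]]].
exists (\row_j rval (T s (k j) (rshift r j))), (\matrix_(i, j) (i == k j)%:R) => v tv.
exists (\row_i ext_weight v (s i)); apply/rowP => j.
rewrite mxE mul_select [X in _ = X + _]mxE [X in _ = _ + X]mxE.
by rewrite (tk j v tv).2 ext_weightr subrK.
Qed.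

(** * A cell of dimension [r] from a generic point *)

Section Generic.
Variable g : 'I_r -> 'I_n.
Let s k := rshift r (g k).
Hypothesis s0 : bdet E s != 0.
Variable kf : 'I_n -> 'I_r.
Hypothesis kf_neq0 : forall j, T s (kf j) (rshift r j) != 0.
Hypothesis kf_min : forall j k, T s k (rshift r j) != 0 -> (kf j <= k)%N.
Variable M : nat.
Hypothesis M_right : forall j k, `|rval (T s k (rshift r j))| * 2%:R + 2%:R <= M%:R.
Hypothesis M_left : forall k i, 2%:R - rval (T s k (lshift n i)) <= M%:R.

(* The point of the tropical linear space with coordinate [u 0 k] at [g k]. *)
Definition section_point (u : 'rV[R]_r) : 'rV[R]_n :=
  \row_j (rval (T s (kf j) (rshift r j)) + u 0 (kf j)).
(* For such [u] the minimum over [k] of [val (T s k j) + u 0 k] is attained at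
   [k = kf j] only. *)
Definition admissible (u : 'rV[R]_r) :=
  forall k : 'I_r, M%:R * k.+1%:R <= u 0 k <= M%:R * k.+1%:R + 1.

Lemma kf_basis k : kf (g k) = k.
Proof.
have := kf_neq0 (g k); rewrite (bmx_basis _ _ s0).
by case: (kf (g k) =P k) => // _; rewrite eqxx.
Qed.

Lemma section_pointE u j :
  section_point u 0 j = rval (T s (kf j) (rshift r j)) + u 0 (kf j).
Proof. by rewrite mxE. Qed.

Lemma section_point_basis u k : ext_weight (section_point u) (s k) = u 0 k.
Proof.
rewrite ext_weightr section_pointE !kf_basis (_ : T s k _ = 1) ?rval1 ?add0r //.
by rewrite (bmx_basis _ _ s0) eqxx.
Qed.

(** The coordinates of [u] grow by about [M] from one index to the next, so among the nonzero
    entries of a column the smallest index [kf j] wins. The successor in [k.+1] gives [u 0 k >= M]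
    also at [k = 0], which keeps the left columns strict. *)
Lemma section_point_strict u k a : admissible u -> T s k a != 0 ->
  (exists2 j, a = rshift r j & k = kf j) \/
  ext_weight (section_point u) a - ext_weight (section_point u) (s k) < rval (T s k a).
Proof.
move=> adm T0; rewrite section_point_basis.
have M0 : 0 <= M%:R :> R by [].
have /andP[uk1 uk2] := adm k; case: (split_ordP a) T0 => i -> T0.
  right; rewrite ext_weightl.
  have : M%:R <= M%:R * k.+1%:R :> R by rewrite ler_peMr // ler1n.
  by move=> Mk; have := M_left k i; move: uk1 Mk; rlra.
have [kE|kne] := eqVneq k (kf i); [left; by exists i|right].
have lt : (kf i < k)%N by rewrite ltn_neqAle eq_sym kne kf_min.
rewrite ext_weightr section_pointE; have /andP[ui1 ui2] := adm (kf i).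
have : M%:R * (kf i).+1%:R + M%:R <= M%:R * k.+1%:R :> R.
  by rewrite -!natrM -natrD ler_nat -mulnSr leq_mul2l ltnS lt orbT.
(* The factor [2] in [M_right] allows averaging: together the two instances bound the sum of both
   absolute values, plus [2], by [M]. *)
have := M_right i k; have := M_right i (kf i).
have := ler_norm (- rval (T s k (rshift r i))); rewrite normrN.
have := ler_norm (rval (T s (kf i) (rshift r i))).
by move: uk1 ui2; rlra.
Qed.

Lemma section_point_tight u j : tight E (ext_weight (section_point u)) s (kf j) (rshift r j).
Proof.
split; first exact: kf_neq0.
by rewrite section_point_basis ext_weightr section_pointE addrK.
Qed.

Lemma section_point_covering u : admissible u -> covering A (section_point u) s.
Proof.
move=> adm; split; last by move=> j; exists (kf j); apply: section_point_tight.
split => // k a; have [->|T0] := eqVneq (T s k a) 0; first exact: vge0.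
apply/(vgeE _ T0); have [[j -> ->]|/ltW //] := section_point_strict adm T0.
by rewrite (section_point_tight u j).2.
Qed.

(** A basis optimal at [u0] is reached from [s] through entries tight there. By strictness these lie
    at the positions [kf j], which are tight for every [u], so the basis stays optimal. *)
Lemma section_point_min_cell u0 u : admissible u0 -> admissible u ->
  min_cell h (section_point u0) (section_point u).
Proof.
move=> adm0 adm J vJ; have os0 := (section_point_covering adm0).1.
have os := (section_point_covering adm).1.
have hJ : h J != +oo%E.
  by case/(sigma_cellP (@entropy_neq_ninfty _ _ _ A) (entropy_neq_pinfty A)): vJ => a ->.
have [s' [s'0 rsJ /(_ _ vJ) os']] := sigma_cell_basis hJ; rewrite -rsJ.
apply: ext_optimal_cell; have [p tp] := optimal_exchange s0 s'0.
apply: (optimal_swap os s'0); exists p => [i|].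
  have [T0 Te] := tp _ os0 os' i.
  have [[j -> ->]|] := section_point_strict adm0 T0; first exact: section_point_tight.
  by rewrite Te ltxx.
rewrite (eq_bigr _ (fun i _ => (tp _ os0 os' i).2)) (weightB_perm _ s s' p).
by have := optimal_le os' s0; rlra.
Qed.

Lemma section_point_dim (u0 : 'rV[R]_r) : (forall k : 'I_r, u0 0 k = M%:R * k.+1%:R) ->
  Sigma_complex h (min_cell h (section_point u0)) /\
  has_dim (min_cell h (section_point u0)) r.
Proof.
move=> u0E; have adm0 : admissible u0 by move=> k; rewrite u0E lexx lerDl ler01.
have tauS : Sigma_complex h (min_cell h (section_point u0)).
  apply: (Sigma_min_cell (@entropy_neq_ninfty _ _ _ A) (entropy_neq_pinfty A)).
  apply/(Sigma_supportP (@entropy_neq_ninfty _ _ _ A) (entropy_neq_pinfty A)).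
  exact: covering_support (section_point_covering adm0).
split => //; have [q [W sub]] := Sigma_cell_affine tauS.
pose W' : 'M[R]_(r, n) := \matrix_(k, j) (k == kf j)%:R.
apply: (has_dim_eq sub (x := section_point u0) (W' := W')) => [|//|k].
  (* Since [kf (g l) = l], the columns [g l] of [W'] form the identity matrix. *)
  apply/row_freeP; exists (\matrix_(j, k) (j == g k)%:R); apply/matrixP => k l.
  rewrite !mxE (bigD1 (g l)) //= !mxE eqxx mulr1 kf_basis big1 ?addr0 // => j /negPf jl.
  by rewrite !mxE jl mulr0.
(* [section_point] is affine in [u], and adding a unit vector uses up the width [1] left by
   [admissible]. *)
have -> : section_point u0 + row k W' = section_point (u0 + delta_mx 0 k).
  apply/rowP => j; rewrite mxE !section_pointE [X in _ + X = _]mxE [W' _ _]mxE.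
  by rewrite [(u0 + _) _ _]mxE [delta_mx _ _ _ _]mxE eqxx /= eq_sym addrA.
apply: section_point_min_cell => // k'; rewrite !mxE eqxx u0E /=.
by case: eqP => _ /=; rewrite ?addr0 lexx ?lerDl ?ler01 ?andbT.
Qed.

End Generic.

Lemma Sigma_dim : row_free A -> (forall j, exists i, A i j != 0) ->
  complex_dim (Sigma_complex h) r.
Proof.
move=> fA colA; split; last first.
  move=> tau k /Sigma_cell_affine[q [W sub]]; exact: (has_dim_le sub).
have [g s0] := right_basis_exists fA; set s := fun k => _ in s0.
have /choice[kf kfP] : forall j, exists k, T s k (rshift r j) != 0 /\
    forall k', T s k' (rshift r j) != 0 -> (k <= k')%N.
  (* A zero column [j] of [T s] would make column [j] of [A] zero. *)
  move=> j; have [k0 k00] : exists k, T s k (rshift r j) != 0.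
    apply: contrapT => nk; have [i /negP] := colA j; apply; apply/eqP.
    have /matrixP/(_ i (rshift r j)) := mul_bmx s0; rewrite /ext_mx row_mxEr => <-.
    rewrite mxE big1 // => k _; apply/eqP; rewrite mulf_eq0; apply/orP; right.
    by apply: contrapT => /negP Tk; apply: nk; exists k.
  case: (@arg_minnP _ k0 (fun k => T s k (rshift r j) != 0) (fun k => k : nat) k00).
  by move=> k Tk kmin; exists k.
have [M1 M1P] := @fin_nat_bound R ('I_n * 'I_r)%type
  (fun jk => `|rval (T s jk.2 (rshift r jk.1))| * 2%:R + 2%:R).
have [M2 M2P] := @fin_nat_bound R ('I_r * 'I_r)%type
  (fun ki => 2%:R - rval (T s ki.1 (lshift n ki.2))).
have M_right j k : `|rval (T s k (rshift r j))| * 2%:R + 2%:R <= (M1 + M2)%:R.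
  by apply: le_trans (M1P (j, k)) _; rewrite ler_nat leq_addr.
have M_left k i : 2%:R - rval (T s k (lshift n i)) <= (M1 + M2)%:R.
  by apply: le_trans (M2P (k, i)) _; rewrite ler_nat leq_addl.
have u0E (k : 'I_r) : (\row_(l < r) ((M1 + M2)%:R * l.+1%:R)) 0 k = (M1 + M2)%:R * k.+1%:R :> R.
  by rewrite mxE.
have [tauS tau_dim] := section_point_dim s0 (fun j => (kfP j).1) (fun j => (kfP j).2)
  M_right M_left u0E.
by eexists; first exact: tauS.
Qed.

End SigmaDimension.

(** * Tropicalization of the lattice, and conclusion *)

Lemma trop_lattice (R : realType) (n r : nat) (A : 'M[puiseux R[i]]_(r, n)) :
  trop_set (lattice_span A) =
  complex_support (Sigma_complex (entropy_vector A)) `&` @rational_points R n.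
Proof.
apply/seteqP; split=> v; last first.
  by move=> [/support_covering[s cov] rv]; apply: covering_trop cov rv.
move=> [_ [c c0 <-] xv]; split; last first.
  move=> j; have [x0 /(puiseux_valE _ x0) <-] := xv j; by eexists.
have [s os] := ext_optimal_exists A v; apply: (covering_support (s := s)).
apply: (trop_covering os (c := c)) => [i|j]; first exact/puiseux_val_ge0.
by have [x0 /(puiseux_valE _ x0)] := xv j.
Qed.

Theorem theorem1p8 (R : realType) (n r : nat)
    (L : set 'rV[puiseux R[i]]_n) (A : 'M[puiseux R[i]]_(r, n))
    (hLA : lattice_basis L A)
    (hL : forall j : 'I_n, exists2 x, L x & x 0 j != 0) :
  let Sigma_L := Sigma_complex (entropy_vector A) in
  [/\ trop_set L = complex_support Sigma_L `&` @rational_points R n,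
      @torus_proj R n @` complex_support Sigma_L = trop_linear_space (Kspan L)
    & complex_dim Sigma_L r].
Proof.
have [fA LE] := hLA; rewrite LE in hL *.
split; [exact: trop_lattice|exact: torus_proj_support|apply: Sigma_dim => // j].
(* A lattice vector with nonzero coordinate [j] has a nonzero summand there, so column [j] of [A] is
   nonzero. *)
have [_ [c _ <-]] := hL j; rewrite mxE => /rval_sum_witness[i [_ + _]].
by rewrite mulf_eq0 negb_or => /andP[_ Aij]; exists i.
Qed.
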